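(* Let $n\ge1$, $0<s<1$, and let $u\in C^{k,\alpha}(\mathbb{R}^n)$, for an integer $k\ge0$ and $0<\alpha\le1$. (i) If $0<2s<\alpha$ then $(-\Delta)^su\in C^{k,\alpha-2s}(\mathbb{R}^n)$ and $$\|(-\Delta)^su\|_{C^{k,\alpha-2s}(\mathbb{R}^n)}\le C\|u\|_{C^{k,\alpha}(\mathbb{R}^n)}.$$ (ii) If $0<\alpha<2s$ and $k\ge1$ then $(-\Delta)^su\in C^{k-1,\alpha-2s+1}(\mathbb{R}^n)$ and $$\|(-\Delta)^su\|_{C^{k-1,\alpha-2s+1}(\mathbb{R}^n)}\le C\|u\|_{C^{k,\alpha}(\mathbb{R}^n)}.$$ The constants $C>0$ above depend only on $n$, $s$, $k$ and $\alpha$.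
   Context: For an integer $k\ge0$ and a Hölder exponent $0<\beta\le1$, $C^{k,\beta}(\mathbb{R}^n)$ is the space of functions with bounded continuous derivatives up to order $k$ whose derivatives of order $k$ are globally $\beta$-Hölder continuous, with its usual full norm (sup norms of all derivatives of order at most $k$ plus the $\beta$-Hölder seminorms of the derivatives of order $k$). The fractional Laplacian $(-\Delta)^s$, $0<s<1$, is given on Schwartz functions by $\widehat{(-\Delta)^su}(\xi)=|\xi|^{2s}\widehat{u}(\xi)$ (Fourier transform normalized so that $\widehat{(-\Delta)u}(\xi)=|\xi|^2\widehat u(\xi)$). For bounded $u$ (more generally, for locally integrable $u$ with $\int_{\mathbb{R}^n}|u(x)|(1+|x|^{n+2s})^{-1}\,dx<\infty$), $(-\Delta)^su$ is the tempered distribution defined by $\langle(-\Delta)^su,f\rangle=\int_{\mathbb{R}^n}u\,(-\Delta)^sf\,dx$ for every Schwartz function $f$. If in addition $u$ is $C^{0,2s+\delta}$ (when $s<1/2$) or $C^{1,2s+\delta-1}$ (when $s\ge1/2$) for some $\delta>0$, then $(-\Delta)^su$ is the continuous function given by the pointwise formula $$(-\Delta)^su(x)=c_{n,s}\lim_{\varepsilon\to0^+}\int_{|x-z|>\varepsilon}\frac{u(x)-u(z)}{|x-z|^{n+2s}}\,dz,\qquad c_{n,s}=\frac{4^s\Gamma(n/2+s)}{|\Gamma(-s)|\pi^{n/2}},$$ equivalently by the semigroup formula $(-\Delta)^su(x)=\frac{1}{\Gamma(-s)}\int_0^\infty\big(e^{t\Delta}u(x)-u(x)\big)\frac{dt}{t^{1+s}}$,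 where $e^{t\Delta}u=G_t*u$ with $G_t(x)=(4\pi t)^{-n/2}e^{-|x|^2/(4t)}$.
   Formalization: In (ii) the formal theorem also assumes α − 2s + 1 > 0; otherwise (s > 1/2 and α ≤ 2s − 1) the exponent of the space C^{k−1,α−2s+1} is not in (0,1] and that space is not defined. *)

(* Defs.v *)
From HB Require Import structures.
From mathcomp Require Import all_boot all_order all_algebra.
From mathcomp Require Import all_classical all_reals all_analysis.

Set Implicit Arguments.
Unset Strict Implicit.
Unset Printing Implicit Defensive.

Import Order.TTheory GRing.Theory Num.Theory.
Import numFieldNormedType.Exports.

Local Open Scope classical_set_scope.
Local Open Scope ring_scope.

Lemma sigma_finite_product_measure d1 d2 (T1 : measurableType d1)
    (T2 : measurableType d2) (R : realType)
    (m1 : {sigma_finite_measure set T1 -> \bar R})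
    (m2 : {sigma_finite_measure set T2 -> \bar R}) :
  sigma_finite setT (m1 \x m2)%E.
Proof.
have /sigma_finiteP[F [TF ndF Foo]] := sigma_finiteT m1.
have /sigma_finiteP[G [TG ndG Goo]] := sigma_finiteT m2.
exists (fun n => F n `*` G n).
 rewrite -setXTT TF TG predeqE => -[x y]; split.
    move=> [/= [n _ Fnx] [k _ Gky]]; exists (maxn n k) => //; split.
    - by move: x Fnx; exact/subsetPset/ndF/leq_maxl.
    - by move: y Gky; exact/subsetPset/ndG/leq_maxr.
  by move=> [n _ []/= ? ?]; split; exists n.
move=> k; have [? ?] := Foo k; have [? ?] := Goo k.
split; first exact: measurableX.
by rewrite product_measure1E// lte_mul_pinfty// ge0_fin_numE.
Qed.

Section lebesgue_tuple.
Variable R : realType.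

Local Notation TR := (measurableTypeR R).

Definition cons_pair n (p : TR * n.-tuple TR) : n.+1.-tuple TR :=
  [tuple of p.1 :: p.2].

Lemma measurable_cons_pair n : measurable_fun setT (@cons_pair n).
Proof. exact: measurable_cons. Qed.

Definition uncons_pair n (t : n.+1.-tuple TR) : TR * n.-tuple TR :=
  (thead t, [tuple of behead t]).

Lemma measurable_uncons_pair n : measurable_fun setT (@uncons_pair n).
Proof.
apply/measurable_fun_pairP; split.
  exact: measurable_tnth.
exact: measurable_behead.
Qed.

Lemma cons_pairK n : cancel (@cons_pair n) (@uncons_pair n).
Proof.
by case=> x t; congr pair; apply/val_inj.
Qed.

Section lebesgue_cons.
Variables (n : nat) (mu : {sigma_finite_measure set (n.-tuple TR) -> \bar R}).

Definition lebesgue_cons : set (n.+1.-tuple TR) -> \bar R :=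
  pushforward (lebesgue_measure \x mu)%E (@cons_pair n).

Let measurable_preimage_cons A : measurable A -> measurable (@cons_pair n @^-1` A).
Proof. by move=> mA; rewrite -[X in measurable X]setTI; exact: measurable_cons_pair. Qed.

Let lebesgue_cons0 : lebesgue_cons set0 = 0%E.
Proof. by rewrite /lebesgue_cons /pushforward preimage_set0 measure0. Qed.

Let lebesgue_cons_ge0 A : (0 <= lebesgue_cons A)%E.
Proof. by rewrite /lebesgue_cons /pushforward; apply: measure_ge0. Qed.

Let lebesgue_cons_semi_sigma_additive : semi_sigma_additive lebesgue_cons.
Proof.
move=> F mF tF mUF; rewrite /lebesgue_cons /pushforward preimage_bigcup.
apply: measure_semi_sigma_additive.
- by move=> i; exact: measurable_preimage_cons.
- apply/trivIsetP => /= i j _ _ ij; rewrite -preimage_setI.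
  by move/trivIsetP : tF => /(_ _ _ _ _ ij) ->//; rewrite preimage_set0.
- by rewrite -preimage_bigcup; exact: measurable_preimage_cons.
Qed.

HB.instance Definition _ := isMeasure.Build _ _ _ lebesgue_cons
  lebesgue_cons0 lebesgue_cons_ge0 lebesgue_cons_semi_sigma_additive.

Let lebesgue_cons_sigma_finite : sigma_finite setT lebesgue_cons.
Proof.
have [F TF Ffin] := sigma_finite_product_measure lebesgue_measure mu.
exists (fun i => @uncons_pair n @^-1` F i).
  by rewrite -preimage_bigcup -TF preimage_setT.
move=> i; have [mF Fi] := Ffin i; split.
  by rewrite -[X in measurable X]setTI; exact: measurable_uncons_pair.
rewrite /lebesgue_cons /pushforward -comp_preimage.
rewrite (_ : _ \o _ = id) ?preimage_id//.
by apply/funext => p /=; rewrite cons_pairK.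
Qed.

HB.instance Definition _ := @Measure_isSigmaFinite.Build _ _ _ lebesgue_cons
  lebesgue_cons_sigma_finite.

End lebesgue_cons.

(* Lebesgue measure on R^n, as the n-fold product of the one on R. It is built
   on n-tuples because these, unlike row vectors, carry the product
   sigma-algebra. *)
Fixpoint lebesgue_tuple n : {sigma_finite_measure set (n.-tuple TR) -> \bar R} :=
  if n is n'.+1 return {sigma_finite_measure set (n.-tuple TR) -> \bar R}
  then lebesgue_cons (lebesgue_tuple n') else dirac [tuple].

Lemma lebesgue_tuple_box n (A : 'I_n -> set TR) :
  (forall i, measurable (A i)) ->
  lebesgue_tuple n [set t | forall i, A i (tnth t i)] =
  (\prod_(i < n) lebesgue_measure (A i))%E.
Proof.
elim: n A => [|n IHn] A mA.
  rewrite big_ord0 /= diracE mem_set//= => -[]//.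
rewrite big_ord_recl /= /lebesgue_cons /pushforward.
rewrite -IHn// -product_measure1E//.
  congr ((_ \x _)%E _); apply/seteqP; split=> -[x t] /=.
    move=> At; split=> [|i]; first by have := At ord0.
    by have := At (lift ord0 i); rewrite tnthS.
  case=> Ax At i; case: (unliftP ord0 i) => [j ->|->//].
  by rewrite tnthS; exact: At.
rewrite [X in measurable X](_ : _ =
    \bigcap_(i in [set: 'I_n]) (@tnth n TR ^~ i @^-1` A (lift ord0 i))).
  apply: fin_bigcap_measurable => //= i _.
  by rewrite -[X in measurable X]setTI; exact: measurable_tnth.
by apply/seteqP; split=> t /= At i; [move=> _|]; apply: At.
Qed.

End lebesgue_tuple.

Section holder_spaces.
Variables (R : realType) (n : nat).
Implicit Types (f u : 'rV[R]_n -> R) (x : 'rV[R]_n).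

(* The norm `|x| carried by 'rV[R]_n in the library is the sup norm. *)
Definition enorm x : R := Num.sqrt (\sum_(i < n) x 0 i ^+ 2).

Definition basis_vec (i : 'I_n) : 'rV[R]_n := delta_mx 0 i.

(* partials [:: i1; ...; im] u is the iterated derivative d_i1 ... d_im u. *)
Definition partials (w : seq 'I_n) u : 'rV[R]_n -> R :=
  foldr (fun i f x => 'D_(basis_vec i) f x) u w.

Definition sup_norm f : \bar R :=
  ereal_sup [set (`|f x|)%:E | x in [set: 'rV[R]_n]].

Definition holder_seminorm (b : R) f : \bar R :=
  ereal_sup [set (`|f p.1 - f p.2| / enorm (p.1 - p.2) `^ b)%:E
            | p in [set p : 'rV[R]_n * 'rV[R]_n | p.1 <> p.2]].

(* The space C^{k,b}(R^n), for 0 < b <= 1. The words w range over all orders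
   of differentiation. *)
Definition holder_space (k : nat) (b : R) u : Prop :=
  [/\ forall (w : seq 'I_n) (i : 'I_n) x, (size w < k)%N ->
        derivable (partials w u) x (basis_vec i),
      forall w : seq 'I_n, (size w <= k)%N ->
        continuous (partials w u) /\ (sup_norm (partials w u) < +oo)%E
    & forall w : seq 'I_n, size w = k ->
        (holder_seminorm b (partials w u) < +oo)%E].

Definition multi_order k (g : {ffun 'I_n -> 'I_k.+1}) : nat :=
  (\sum_(i < n) g i)%N.

Definition multi_partial k (g : {ffun 'I_n -> 'I_k.+1}) u : 'rV[R]_n -> R :=
  partials (flatten [seq nseq (g i) i | i <- enum 'I_n]) u.

(* The multi-indices of order at most k are the functions g : 'I_n -> 'I_k.+1
   with multi_order g <= k. *)
Definition holder_norm (k : nat) (b : R) u : \bar R :=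
  (\sum_(g : {ffun 'I_n -> 'I_k.+1} | (multi_order g <= k)%N)
      sup_norm (multi_partial g u)
   + \sum_(g : {ffun 'I_n -> 'I_k.+1} | multi_order g == k)
      holder_seminorm b (multi_partial g u))%E.

End holder_spaces.

Section fractional_laplacian.
Variable R : realType.

(* Euler's integral, extended to negative non-integers by
   Gamma (x + m) = x (x + 1) ... (x + m - 1) Gamma x. *)
Definition Gamma_integral (x : R) : R :=
  \int[lebesgue_measure]_(t in `]0, +oo[) (t `^ (x - 1) * expR (- t)).

Definition Gamma (x : R) : R :=
  if 0 < x then Gamma_integral x else
  let m := (Num.truncn (- x)).+1 in
  Gamma_integral (x + m%:R) / \prod_(i < m) (x + i%:R).

Variables (n : nat) (s : R).
Implicit Types (u : 'rV[R]_n -> R) (x : 'rV[R]_n) (t : n.-tuple (measurableTypeR R)).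

Definition frac_const : R :=
  4 `^ s * Gamma (n%:R / 2 + s) / (`|Gamma (- s)| * pi `^ (n%:R / 2)).

Definition point t : 'rV[R]_n := \row_i tnth t i.

Definition frac_integrand u x t : R :=
  (u x - u (point t)) / enorm (x - point t) `^ (n%:R + 2 * s).

Definition outside_ball x (e : R) : set (n.-tuple (measurableTypeR R)) :=
  [set t | e < enorm (x - point t)].

(* c_{n,s} times the integral over |x - z| > e, where z = point t. *)
Definition frac_truncated u x (e : R) : R :=
  frac_const *
  \int[lebesgue_tuple R n]_(t in outside_ball x e) frac_integrand u x t.

(* The defining limit exists at every point, as a limit of genuine Lebesgue
   integrals; without this, frac_laplacian u x is a default value. *)
Definition has_frac_laplacian u : Prop := forall x,
  (forall e : R, 0 < e ->
     (lebesgue_tuple R n).-integrable (outside_ball x e)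
       (EFin \o frac_integrand u x)) /\
  cvg (frac_truncated u x e @[e --> 0^'+]).

Definition frac_laplacian u x : R := lim (frac_truncated u x e @[e --> 0^'+]).

End fractional_laplacian.

(* Main.v *)
Require Import Defs.
From mathcomp Require Import all_boot all_order all_algebra.
From mathcomp Require Import all_classical all_reals all_analysis.
From mathcomp Require Import measurable_realfun.
From mathcomp Require Import ring lra.
Import Order.TTheory GRing.Theory Num.Theory.
Local Open Scope ring_scope.

Set Implicit Arguments.
Unset Strict Implicit.
Unset Printing Implicit Defensive.

Import numFieldNormedType.Exports.
Local Open Scope classical_set_scope.

(* [point] also names the base point of a pointed type. *)
Local Notation point := Defs.point.

(** The idea. Write L for the operator (-Delta)^s and
      d_v(x, y) = 2 v(x) - v(x + y) - v(x - y).
    Lebesgue measure is invariant under the reflection z |-> 2 x - z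
    ([lebesgue_tuple_reflect]), so the truncated integrals defining L v(x) are,
    up to a constant, integrals over |x - z| > e of
    d_v(x, z - x) |x - z|^(- n - 2s) ([frac_truncated_sym]). Near the diagonal
    |y|^(g - n - 2s) is integrable when g > 2s, and far from it
    |y|^(b - n - 2s) is integrable when b < 2s; a decomposition in dyadic shells
    shows this, with integrals of order r^(g - 2s) and r^(b - 2s)
    ([integral_kernel_near], [integral_kernel_far]). Hence the one estimate on
    which everything rests ([frac_laplacian_pointwise]): if v is bounded
    and continuous, and |d_v(x, y)| is at most A1 |y|^g for |y| <= r and at most
    A2 |y|^b for |y| > r, then the limit defining L v(x) exists and
      |L v(x)| <= C (A1 r^(g - 2s) + A2 r^(b - 2s)).

    Let d_v(x, y) = O(|y|^g) everywhere, where g > 2s. Since L is linear and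
    commutes with translations, the estimate gives three facts.
    - With r = 1 and b = 0, it bounds L v ([frac_laplacian_sup]).
    - Applied to v(. + h) - v with r = |h|, it bounds L v(x + h) - L v(x) by
      C |h|^(g - 2s), as soon as d_v(x + h, y) - d_v(x, y) is
      O(|h|^(g - b) |y|^b) ([frac_laplacian_holder]).
    - Applied to a difference quotient of v minus the derivative, with r a small
      power of the increment, it shows that partial derivatives commute with L
      ([frac_laplacian_derive]).

    When 2s < a, each derivative of u of order at most k is Hoelder continuous of
    exponent a, and g = a, b = 0 are suitable ([regular_holder]). When
    a < 2s < 1 + a, each derivative of order less than k has partial derivatives
    that are Hoelder continuous of exponent a, and the mean value theorem along
    coordinate paths makes g = 1 + a, b = a suitable ([regular_partials]). In
    both cases g - 2s is the exponent of the conclusion. The norm lists one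
    derivative per multi-index, whereas the argument meets derivatives taken in
    arbitrary order; [partials_perm], which rests on the symmetry of mixed
    derivatives, identifies them. *)

(** * The Euclidean norm *)

Section euclidean_norm.
Variables (R : realType) (n : nat).
Implicit Types x y : 'rV[R]_n.

Lemma enorm_ge0 x : 0 <= enorm x.
Proof. exact: sqrtr_ge0. Qed.

Lemma enormN x : enorm (- x) = enorm x.
Proof. by rewrite /enorm; under eq_bigr do rewrite mxE sqrrN. Qed.

Lemma enormB x y : enorm (x - y) = enorm (y - x).
Proof. by rewrite -enormN opprB. Qed.

Lemma enorm0 : enorm (0 : 'rV[R]_n) = 0.
Proof. by rewrite /enorm big1 ?sqrtr0// => i _; rewrite mxE expr0n. Qed.

Lemma coord_le_enorm x i : `|x 0 i| <= enorm x.
Proof.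
rewrite -[leLHS]sqrtr_sqr ler_wsqrtr// (bigD1 i)//= lerDl sumr_ge0//.
by move=> j _; exact: sqr_ge0.
Qed.

Lemma enorm_gt0 x : (0 < enorm x) = (x != 0).
Proof.
apply/idP/idP => [|x0]; first by apply: contraTneq => ->; rewrite enorm0 ltxx.
rewrite lt_neqAle enorm_ge0 andbT eq_sym; apply: contra x0 => /eqP xE.
apply/eqP/rowP => i; rewrite mxE; apply/eqP; rewrite -normr_le0 -xE.
exact: coord_le_enorm.
Qed.

Lemma le_enorm x y : (forall i, `|x 0 i| <= `|y 0 i|) -> enorm x <= enorm y.
Proof.
move=> xy; rewrite ler_wsqrtr// ler_sum// => i _.
by rewrite -[x 0 i ^+ 2]real_normK ?num_real// -[leRHS]real_normK ?num_real// lerXn2r ?nnegrE.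
Qed.

Lemma enorm_basis (i : 'I_n) (h : R) : enorm (h *: basis_vec R i) = `|h|.
Proof.
rewrite /enorm (bigD1 i)//= big1 => [|j ji].
  by rewrite addr0 !mxE !eqxx mulr1 sqrtr_sqr.
by rewrite !mxE (negbTE ji) andbF mulr0 expr0n.
Qed.

Lemma coord_le_norm x i : `|x 0 i| <= `|x|.
Proof.
rewrite [leRHS]/Num.Def.normr/= mx_normrE.
exact: (le_bigmax _ (fun ij : 'I_1 * 'I_n => `|x ij.1 ij.2|) (0, i)).
Qed.

(** Comparison with the sup norm, which defines the topology of row vectors. *)
Lemma enorm_le_norm x : enorm x <= n%:R * `|x|.
Proof.
rewrite -[leRHS]ger0_norm ?mulr_ge0// -sqrtr_sqr ler_wsqrtr//.
apply: (@le_trans _ _ (\sum_(i < n) `|x| ^+ 2)).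
  by apply: ler_sum => i _; rewrite -real_normK ?num_real// lerXn2r ?nnegrE//
    coord_le_norm.
rewrite sumr_const card_ord exprMn -[leLHS]mulr_natl ler_wpM2r ?sqr_ge0//.
by rewrite -natrX ler_nat; case: n => // m; rewrite leq_pmulr.
Qed.

End euclidean_norm.

Section affine_continuity.
Variables (R : realType) (V : normedModType R).

Lemma continuous_shift (h : V) : continuous (fun z => z + h).
Proof.
move=> z; apply: (@cvgD _ _ _ (nbhs z) _ id (fun=> h)); first exact: cvg_id.
exact: cvg_cst.
Qed.

Lemma continuous_reflection (x y : V) : continuous (fun z => x - (z - y)).
Proof.
move=> z; apply: (@cvgB _ _ _ (nbhs z) _ (fun=> x) (fun z => z - y)).
  exact: cvg_cst.
exact: continuous_shift.
Qed.

End affine_continuity.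

(** * Measurability and invariance of Lebesgue measure *)

Section measurability.
Variables (R : realType) (n : nat).
Local Notation TR := (measurableTypeR R).
Implicit Types (x : 'rV[R]_n) (u : 'rV[R]_n -> R).

Lemma measurable_tuple_box (A : 'I_n -> set TR) :
  (forall i, measurable (A i)) ->
  measurable [set t : n.-tuple TR | forall i, A i (tnth t i)].
Proof.
move=> mA; rewrite [X in measurable X](_ : _ =
    \bigcap_(i in [set: 'I_n]) (@tnth n TR ^~ i @^-1` A i)).
  apply: fin_bigcap_measurable => //= i _.
  by rewrite -[X in measurable X]setTI; exact: measurable_tnth.
by apply/seteqP; split=> t /= At i; [move=> _|]; exact: At.
Qed.

(** An open set is a countable union of boxes with rational vertices. *)
Lemma measurable_preimage_point (U : set 'rV[R]_n) :
  open U -> measurable (@point R n @^-1` U).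
Proof.
move=> oU.
pose box (p : {ffun 'I_n -> rat} * {ffun 'I_n -> rat}) : set (n.-tuple TR) :=
  [set t | forall i, `]ratr (p.1 i), ratr (p.2 i)[%classic (tnth t i)].
pose F p := if `[< box p `<=` @point R n @^-1` U >] then box p else set0.
rewrite (_ : _ @^-1` _ = \bigcup_p F p); last first.
  apply/seteqP; split => [t Ut|t [p _]]; last first.
    by rewrite /F; case: ifPn => // /asboolP bU /bU.
  have /nbhs_ballP[e /= e0 eU] : nbhs (point t) U by exact: open_nbhs_nbhs.
  have /choice[a ha] (i : 'I_n) : exists q : rat,
      (ratr q : R) \in `](tnth t i - e : R), (tnth t i : R)[%R.
    by apply: (@rat_in_itvoo R); rewrite ltrBlDr ltrDl.
  have /choice[b hb] (i : 'I_n) : exists q : rat,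
      (ratr q : R) \in `](tnth t i : R), (tnth t i + e : R)[%R.
    by apply: (@rat_in_itvoo R); rewrite ltrDl.
  have abt : box ([ffun i => a i], [ffun i => b i]) t.
    by move=> i /=; rewrite !ffunE in_itv/= (itvP (ha i)) (itvP (hb i)).
  exists ([ffun i => a i], [ffun i => b i]) => //.
  rewrite /F; case: asboolP => // -[] t' abt'; apply: eU; split=> // i0 i.
  have := abt' i; rewrite /= !ffunE in_itv/= => /andP[].
  rewrite /ball/= !mxE; move: (ha i) (hb i); rewrite !in_itv/=.
  by move=> /andP[? ?] /andP[? ?] ? ?; rewrite ltr_norml; lra.
apply: (countable_bigcupT_measurable (F := F)) => [|p]; first exact: countableP.
rewrite /F; case: ifP => _; last exact: measurable0.
apply: (@measurable_tuple_box
  (fun i => `]ratr (p.1 i), ratr (p.2 i)[%classic : set TR)) => i.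
exact: measurable_itv.
Qed.

Lemma measurable_fun_point u : continuous u ->
  measurable_fun setT (u \o @point R n : n.-tuple TR -> TR).
Proof.
move=> /continuousP cu; apply: (measurability _ (RGenOpens.measurableE R)).
move=> _ [_ [a [b ->] <-]]; rewrite setTI comp_preimage.
by apply: measurable_preimage_point; apply: cu; exact: interval_open.
Qed.

Lemma measurable_fun_coord (i : 'I_n) :
  measurable_fun setT (fun t : n.-tuple TR => tnth t i : TR).
Proof. exact: measurable_tnth. Qed.

Lemma measurable_enorm_point x :
  measurable_fun setT (fun t : n.-tuple TR => enorm (x - point t) : TR).
Proof.
apply: (@measurableT_comp _ _ _ _ _ _ (@Num.sqrt R)).
  exact: continuous_measurable_fun (@sqrt_continuous R).
apply: (@measurable_sum _ _ _ _ _ _ (fun i (t : n.-tuple TR) => ((x - point t) 0 i) ^+ 2)).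
move=> i; under eq_fun do rewrite !mxE.
apply: measurable_funX; apply: measurable_funB => //.
exact: measurable_fun_coord.
Qed.

Lemma measurable_outside_ball x e : measurable (outside_ball x e).
Proof.
rewrite (_ : outside_ball x e =
  (fun t => enorm (x - point t)) @^-1` `]e, +oo[%classic); last first.
  by apply/seteqP; split => t /=; rewrite in_itv/= andbT.
by rewrite -[X in measurable X]setTI; apply: measurable_enorm_point.
Qed.

Lemma measurable_frac_integrand s u x : continuous u ->
  measurable_fun setT (frac_integrand s u x).
Proof.
move=> cu; apply: measurable_funM.
  by apply: measurable_funB => //; exact: measurable_fun_point.
under eq_fun do rewrite -powRN.
exact: measurableT_comp (measurable_powR _) (measurable_enorm_point _).
Qed.

End measurability.

Section reflection.
Variable R : realType.
Local Notation TR := (measurableTypeR R).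

(** The reflection z |-> x - z of R^n, read on tuples. *)
Definition reflect n (x : 'rV[R]_n) (t : n.-tuple TR) : n.-tuple TR :=
  [tuple x 0 i - tnth t i | i < n].

Lemma point_reflect n (x : 'rV[R]_n) t : point (reflect x t) = x - point t.
Proof. by apply/rowP => i; rewrite !mxE tnth_mktuple. Qed.

Lemma measurable_reflect n (x : 'rV[R]_n) : measurable_fun setT (reflect x).
Proof.
apply/measurable_fun_tnthP => i.
rewrite (_ : _ \o _ = fun t : n.-tuple TR => x 0 i - tnth t i); last first.
  by apply/funext => t /=; rewrite tnth_mktuple.
by apply: measurable_funB => //; exact: measurable_fun_coord.
Qed.

Lemma measurable_preimage_reflect n (x : 'rV[R]_n) A :
  measurable A -> measurable (reflect x @^-1` A).
Proof. by move=> mA; rewrite -[X in measurable X]setTI; exact: measurable_reflect. Qed.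

Lemma lebesgue_measure_reflect (c : R) (A : set TR) : measurable A ->
  lebesgue_measure ((fun a => c - a) @^-1` A) = lebesgue_measure A.
Proof.
have mf : measurable_fun setT (fun a : TR => c - a : TR).
  exact: measurable_funB.
move=> mA; apply/esym.
apply: (@lebesgue_measure_unique R
  (pushforward lebesgue_measure (fun a : TR => c - a : TR))) => //.
move=> _ [[a b] /= _ <-]; rewrite /pushforward.
rewrite (_ : _ @^-1` _ = `[c - b, c - a[%classic); last first.
  by apply/seteqP; split => z /=; rewrite !in_itv/=; lra.
rewrite !lebesgue_measure_itv/= !lte_fin ltrD2l ltrN2 -!EFinB.
by rewrite (_ : c - a - (c - b) = b - a)//; ring.
Qed.

Lemma lebesgue_tuple_reflect n (x : 'rV[R]_n) A : measurable A ->
  lebesgue_tuple R n (reflect x @^-1` A) = lebesgue_tuple R n A.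
Proof.
elim: n x A => [|n IHn] x A mA.
  rewrite (_ : _ @^-1` _ = A)//; apply/seteqP.
  by split=> t /=; rewrite (_ : reflect x t = t)//; rewrite [LHS]tuple0 [RHS]tuple0.
pose y : 'rV[R]_n := \row_i x 0 (lift ord0 i).
pose f (p : TR * n.-tuple TR) : TR * n.-tuple TR := (x 0 0 - p.1, reflect y p.2).
have mf : measurable_fun setT f.
  apply/measurable_fun_pairP; split.
    exact: measurable_funB.
  exact: measurableT_comp (measurable_reflect _) _.
have mB : measurable (@cons_pair R n @^-1` A).
  by rewrite -[X in measurable X]setTI; exact: measurable_cons_pair.
rewrite /= /lebesgue_cons /pushforward.
have fE p : reflect x (cons_pair p) = cons_pair (f p).
  case: p => a t; apply: eq_from_tnth => i.
  rewrite tnth_mktuple; case: (unliftP ord0 i) => [j ->|->] /=.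
    by rewrite !tnthS tnth_mktuple mxE.
  by rewrite !tnth0.
rewrite (_ : _ @^-1` (_ @^-1` _) = f @^-1` (@cons_pair R n @^-1` A)); last first.
  by apply/seteqP; split => p; rewrite /preimage/= fE.
apply/esym.
apply: (@product_measure_unique _ _ _ _ _ lebesgue_measure (lebesgue_tuple R n)
  (pushforward (lebesgue_measure \x lebesgue_tuple R n)%E f)) => //.
move=> X Y mX mY; rewrite /pushforward.
transitivity ((lebesgue_measure \x lebesgue_tuple R n)%E
    (((fun a : TR => x 0 0 - a : TR) @^-1` X) `*` (reflect y @^-1` Y))); first by [].
have mX' : measurable ((fun a : TR => x 0 0 - a : TR) @^-1` X).
  by rewrite -[X in measurable X]setTI; apply: (measurable_funB _ _) => //.
rewrite product_measure1E//; last exact: measurable_preimage_reflect.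
by congr (_ * _)%E; [exact: lebesgue_measure_reflect|exact: IHn].
Qed.

End reflection.

Section reflection_integral.
Variables (R : realType) (n : nat).
Local Notation TR := (measurableTypeR R).
Local Notation mu := (lebesgue_tuple R n).
Implicit Types (x : 'rV[R]_n) (D : set (n.-tuple TR)).

Lemma ge0_integral_reflect x D (f : n.-tuple TR -> \bar R) :
  measurable D -> measurable_fun D f -> {in D, forall y, 0 <= f y}%E ->
  (\int[mu]_(t in D) f t =
   \int[mu]_(t in reflect x @^-1` D) f (reflect x t))%E.
Proof.
move=> mD mf f0.
rewrite -(ge0_integral_pushforward (measurable_reflect x))//.
apply: eq_measure_integral => [|mr A mA _]; first exact: measurable_reflect.
by apply/esym; exact: lebesgue_tuple_reflect.
Qed.

Lemma integrable_reflect x D (f : n.-tuple TR -> \bar R) :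
  measurable D -> measurable_fun setT f -> mu.-integrable D f ->
  mu.-integrable (reflect x @^-1` D) (f \o reflect x).
Proof.
move=> mD mf /integrableP[_ foo]; apply/integrableP; split.
  by apply: measurable_funTS; exact: measurableT_comp (measurable_reflect _).
rewrite -(ge0_integral_reflect x (f := fun t => `|f t|%E))//.
by apply: measurable_funTS; exact: measurableT_comp.
Qed.

Lemma Rintegral_reflect x D (f : n.-tuple TR -> R) :
  measurable D -> measurable_fun setT f -> mu.-integrable D (EFin \o f) ->
  \int[mu]_(t in D) f t =
  \int[mu]_(t in reflect x @^-1` D) f (reflect x t).
Proof.
move=> mD mf intf; congr fine.
rewrite -(integral_pushforward (measurable_reflect x) (f := EFin \o f))//.
- apply: eq_measure_integral => [|mr A mA _]; first exact: measurable_reflect.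
  by apply/esym; exact: lebesgue_tuple_reflect.
- exact/measurable_EFinP.
- by apply: integrable_reflect => //; exact/measurable_EFinP.
Qed.

(** The translation z |-> z + h, as a product of two reflections. *)
Definition translate (h : 'rV[R]_n) (t : n.-tuple TR) : n.-tuple TR :=
  reflect h (reflect 0 t).

Lemma point_translate h t : point (translate h t) = point t + h.
Proof. by rewrite !point_reflect sub0r opprK addrC. Qed.

Lemma Rintegral_translate (h : 'rV[R]_n) D (f : n.-tuple TR -> R) :
  measurable D -> measurable_fun setT f -> mu.-integrable D (EFin \o f) ->
  \int[mu]_(t in D) f t =
  \int[mu]_(t in translate h @^-1` D) f (translate h t).
Proof.
move=> mD mf intf; transitivity (\int[mu]_(t in reflect h @^-1` D) f (reflect h t)).
  exact: Rintegral_reflect.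
apply: (@Rintegral_reflect 0 _ (f \o reflect h)).
- exact: measurable_preimage_reflect.
- exact: measurableT_comp (measurable_reflect _).
- apply: (@integrable_reflect h D (EFin \o f)) => //.
  exact/measurable_EFinP.
Qed.

End reflection_integral.

(** * Integrals of power kernels *)

Section annuli.
Variables (R : realType) (n : nat).
Local Notation TR := (measurableTypeR R).
Local Notation mu := (lebesgue_tuple R n).
Implicit Types (x : 'rV[R]_n) (p q r : R).

Lemma lebesgue_tuple_ball_le x r : 0 <= r ->
  (mu [set t | (enorm (x - point t) <= r)%R] <= ((2 * r) ^+ n)%:E)%E.
Proof.
move=> r0.
pose A (i : 'I_n) : set TR := `[x 0 i - r, x 0 i + r]%classic.
have mA i : measurable (A i) by exact: measurable_itv.
have -> : ((2 * r) ^+ n)%:E = mu [set t | forall i, A i (tnth t i)].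
  rewrite lebesgue_tuple_box//.
  rewrite (eq_bigr (fun=> (2 * r)%:E)); last first.
    move=> i _; rewrite /A lebesgue_measure_itv/= lte_fin -EFinB.
    rewrite (_ : x 0 i + r - (x 0 i - r) = 2 * r); last by ring.
    case: ltP => // h; congr EFin; lra.
  by rewrite prodEFin big_const_ord iter_mulr_1.
apply: le_measure; rewrite ?inE.
- rewrite (_ : [set t | _] = ~` outside_ball x r).
    by apply: measurableC; exact: measurable_outside_ball.
  by apply/seteqP; split => t /=; rewrite /outside_ball/= leNgt => /negP.
- exact: measurable_tuple_box.
- move=> t /= tr i; rewrite /A/= in_itv/=.
  have := le_trans (coord_le_enorm (x - point t) i) tr.
  by rewrite !mxE ler_norml => /andP[? ?]; apply/andP; split; lra.
Qed.

(** The half-open spherical shell a < |x - z| <= b. *)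
Definition annulus x (a b : R) : set (n.-tuple TR) :=
  [set t | a < enorm (x - point t) <= b].

Lemma annulusE x a b : annulus x a b = outside_ball x a `\` outside_ball x b.
Proof.
apply/seteqP; split => t; rewrite /annulus /outside_ball/=.
  by move=> /andP[? h]; split => //; apply/negP; rewrite -leNgt.
by move=> [-> /negP]; rewrite -leNgt.
Qed.

Lemma measurable_annulus x a b : measurable (annulus x a b).
Proof. by rewrite annulusE; apply: measurableD; exact: measurable_outside_ball. Qed.

(** The kernel |x - z|^p, equal at z = x to the conventional value of 0^p. *)
Definition kernel x p (t : n.-tuple TR) : R := enorm (x - point t) `^ p.

Lemma measurable_kernel x p D : measurable_fun D (kernel x p : _ -> TR).
Proof.
apply: measurable_funTS.
exact: measurableT_comp (measurable_powR _) (measurable_enorm_point _).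
Qed.

Lemma kernel_ge0 x p t : 0 <= kernel x p t.
Proof. exact: powR_ge0. Qed.

Lemma powR_annulus_le p r y : 0 < r -> r < y <= 2 * r -> y `^ p <= 2 `^ `|p| * r `^ p.
Proof.
move=> r0 /andP[ry y2r]; have y0 : 0 < y by lra.
have [p0|p0] := leP 0 p.
  by rewrite ger0_norm// -powRM ?(ltW r0)//; apply: ge0_ler_powR; rewrite ?nnegrE; lra.
have [e e0 ->] : exists2 e, 0 < e & p = - e by exists (- p); lra.
rewrite normrN gtr0_norm// !powRN.
apply: (@le_trans _ _ (r `^ e)^-1).
  rewrite lef_pV2 ?posrE ?powR_gt0//.
  by apply: ge0_ler_powR; rewrite ?nnegrE; lra.
rewrite ler_peMl ?invr_ge0 ?powR_ge0// -[leLHS](powRr0 2).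
by apply: ler_powR; lra.
Qed.

(** The constant in the bound of the integral of |x - z|^(q - n) over the shell
    r < |x - z| <= 2 r. *)
Definition annulus_const q : R := 2 `^ `|q - n%:R| * 4 ^+ n.

Lemma annulus_const_ge0 q : 0 <= annulus_const q.
Proof. by rewrite mulr_ge0 ?powR_ge0 ?exprn_ge0. Qed.

Lemma integral_annulus_le x q r : 0 < r ->
  (\int[mu]_(t in annulus x r (2 * r)) (kernel x (q - n%:R) t)%:E
   <= (annulus_const q * r `^ q)%:E)%E.
Proof.
move=> r0; set M := 2 `^ `|q - n%:R| * r `^ (q - n%:R).
have M0 : 0 <= M by rewrite mulr_ge0 ?powR_ge0.
apply: (@le_trans _ _ (\int[mu]_(t in annulus x r (2 * r)) M%:E)%E).
  apply: ge0_le_integral => //.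
  - exact: measurable_annulus.
  - by move=> t _; rewrite lee_fin kernel_ge0.
  - by apply/measurable_EFinP; exact: measurable_kernel.
  - by move=> t h; rewrite lee_fin powR_annulus_le.
rewrite integral_cst; last exact: measurable_annulus.
apply: (@le_trans _ _ (M%:E * ((2 * (2 * r)) ^+ n)%:E)%E).
  rewrite lee_wpmul2l ?lee_fin//.
  apply: le_trans (lebesgue_tuple_ball_le x _); last by lra.
  apply: le_measure; rewrite ?inE.
  - exact: measurable_annulus.
  - rewrite (_ : [set t | _] = ~` outside_ball x (2 * r)).
      by apply: measurableC; exact: measurable_outside_ball.
    by apply/seteqP; split => t /=; rewrite /outside_ball/= leNgt => /negP.
  - by move=> t /andP[].
rewrite -EFinM lee_fin le_eqVlt; apply/orP; left; apply/eqP.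
rewrite /M /annulus_const powRD; last by rewrite (gt_eqF r0) implybT.
rewrite powRN powR_mulrn ?(ltW r0)// (_ : 2 * (2 * r) = 4 * r); last by ring.
by rewrite exprMn; field; rewrite expf_neq0// gt_eqF.
Qed.

Lemma geometric_nneseries_le (a th : R) : 0 <= a -> 0 <= th < 1 ->
  (\sum_(0 <= i <oo) (a * th ^+ i)%:E <= (a / (1 - th))%:E)%E.
Proof.
move=> a0 /andP[th0 th1]; apply: lime_le.
  by apply: is_cvg_nneseries => i _ _; rewrite lee_fin mulr_ge0 ?exprn_ge0.
apply: nearW => m; rewrite sumEFin lee_fin.
rewrite -[leLHS]/(series (geometric a th) m) geometric_seriesE ?lt_eqF//.
rewrite ler_pM2r ?invr_gt0 ?subr_gt0// ler_piMr// lerBlDr lerDl.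
exact: exprn_ge0.
Qed.

(** Summing over shells whose radii form a geometric sequence. *)
Lemma integral_annuli_le x q (rho : nat -> R) (th : R) (D : set (n.-tuple TR)) :
  (forall j, 0 < rho j) -> 0 <= th < 1 ->
  (forall j, rho j `^ q = rho 0%N `^ q * th ^+ j) ->
  (forall i j, i != j -> 2 * rho i <= rho j \/ 2 * rho j <= rho i) ->
  D = \bigcup_j annulus x (rho j) (2 * rho j) ->
  (\int[mu]_(t in D) (kernel x (q - n%:R) t)%:E
   <= (annulus_const q / (1 - th) * rho 0%N `^ q)%:E)%E.
Proof.
move=> rho0 th01 rhoE rhoD ->.
rewrite ge0_integral_bigcup//.
- apply: (@le_trans _ _ (\sum_(0 <= i <oo) (annulus_const q * rho 0%N `^ q * th ^+ i)%:E)%E).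
    apply: lee_nneseries => [i _ _|i _].
      by apply: integral_ge0 => t _; rewrite lee_fin kernel_ge0.
    by rewrite -mulrA -rhoE integral_annulus_le.
  rewrite (_ : annulus_const q / (1 - th) * _ =
    annulus_const q * rho 0%N `^ q / (1 - th)); last by rewrite mulrAC.
  apply: geometric_nneseries_le => //.
  by rewrite mulr_ge0 ?annulus_const_ge0 ?powR_ge0.
- by move=> j; exact: measurable_annulus.
- by apply/measurable_EFinP; exact: measurable_kernel.
- by move=> t _; rewrite lee_fin kernel_ge0.
- apply/trivIsetP => i j _ _ ij; apply/seteqP; split => // t [] /andP[/= ? ?] /andP[? ?].
  by have [] := rhoD i j ij; lra.
Qed.

Lemma exists_pow2_gt (y : R) : exists j, y < 2 ^+ j.
Proof.
exists (Num.truncn y).+1; apply: lt_trans (truncnS_gt y) _.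
by rewrite -natrX ltr_nat ltn_expl.
Qed.

Lemma far_annuliE x r : 0 < r ->
  outside_ball x r = \bigcup_j annulus x (r * 2 ^+ j) (2 * (r * 2 ^+ j)).
Proof.
move=> r0; apply/seteqP; split => t; rewrite /outside_ball/=; last first.
  move=> [j _ /andP[+ _]]; apply: le_lt_trans.
  by rewrite ler_peMr ?(ltW r0)// exprn_ege1// ler1n.
set y := enorm _ => ry.
have ex : exists j, y <= 2 * (r * 2 ^+ j).
  have [j hj] := exists_pow2_gt (y / r); exists j.
  move: hj; rewrite ltr_pdivrMr// => hj.
  have : 0 < r * 2 ^+ j by rewrite mulr_gt0// exprn_gt0.
  by lra.
case: (ex_minnP ex) => j hj jmin; exists j => //; apply/andP; split=> //.
rewrite -/y; case: j hj jmin => [|j] hj jmin; first by rewrite expr0 mulr1.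
rewrite ltNge; apply/negP => h.
have := jmin j; rewrite ltnn => H; have // : false; apply: H.
by move: h; rewrite exprS mulrCA.
Qed.

Lemma near_annuliE x r : 0 < r ->
  annulus x 0 r = \bigcup_j annulus x (r / 2 * (2^-1) ^+ j) (2 * (r / 2 * (2^-1) ^+ j)).
Proof.
move=> r0.
have E j : 2 * (r / 2 * 2^-1 ^+ j) = r * 2^-1 ^+ j by field.
apply/seteqP; split => t; rewrite /annulus/=; last first.
  move=> [j _ /andP[h1 h2]]; apply/andP; split.
    by apply: lt_trans h1; rewrite mulr_gt0 ?divr_gt0 ?exprn_gt0 ?invr_gt0.
  apply: (le_trans h2); rewrite E ler_piMr ?(ltW r0)// exprn_ile1 ?invr_ge0//.
  by rewrite invf_le1// ler1n.
set y := enorm _ => /andP[y0 yr].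
have ex : exists j, r / 2 * 2^-1 ^+ j < y.
  have [j hj] := exists_pow2_gt (r / 2 / y); exists j.
  by move: hj; rewrite exprVn !ltr_pdivrMr ?exprn_gt0// [y * _]mulrC.
case: (ex_minnP ex) => j hj jmin; exists j => //; apply/andP; split=> //.
rewrite -/y E; case: j hj jmin => [|j] hj jmin; first by rewrite expr0 mulr1.
rewrite leNgt; apply/negP => h.
have := jmin j; rewrite ltnn => H; have // : false; apply: H.
by move: h; rewrite exprS mulrA.
Qed.

Lemma pow2_separated (i j : nat) : (i < j)%N -> (2 : R) * 2 ^+ i <= 2 ^+ j.
Proof. by move=> ij; rewrite -exprS ler_eXn2l// ltr1n. Qed.

(** Integrability of |x - z|^(q - n) near the diagonal when q > 0. *)
Lemma integral_kernel_near q : 0 < q -> exists2 K, 0 <= K & forall x r, 0 < r ->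
  (\int[mu]_(t in annulus x 0 r) (kernel x (q - n%:R) t)%:E <= (K * r `^ q)%:E)%E.
Proof.
move=> q0; pose th : R := 2^-1 `^ q.
have th01 : 0 <= th < 1.
  rewrite powR_ge0/= /th; apply/(@lt_le_trans _ _ (1 `^ q)); last by rewrite powR1.
  by apply: gt0_ltr_powR; rewrite ?nnegrE ?invr_ge0//; lra.
exists (annulus_const q / (1 - th) * 2^-1 `^ q).
  rewrite mulr_ge0 ?powR_ge0// divr_ge0 ?annulus_const_ge0// subr_ge0 ltW//.
  by case/andP: th01.
move=> x r r0.
have := @integral_annuli_le x q (fun j => r / 2 * (2^-1) ^+ j) th (annulus x 0 r).
rewrite expr0 mulr1 powRM ?invr_ge0 ?(ltW r0)// => H.
rewrite (_ : annulus_const q / (1 - th) * 2^-1 `^ q * r `^ q =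
  annulus_const q / (1 - th) * (r `^ q * 2^-1 `^ q)); last by ring.
apply: H => //.
- by move=> j; rewrite mulr_gt0 ?divr_gt0 ?exprn_gt0 ?invr_gt0.
- move=> j; rewrite powRM ?exprn_ge0 ?invr_ge0 ?divr_ge0 ?(ltW r0)//.
  rewrite powRM ?invr_ge0 ?(ltW r0)//.
  congr (_ * _); rewrite -[2^-1 ^+ j]powR_mulrn ?invr_ge0// -powRrM mulrC powRrM.
  by rewrite powR_mulrn// powR_ge0.
- move=> i j ij; wlog lt_ij : i j ij / (i < j)%N => [H'|].
    move: (ij); rewrite neq_ltn => /orP[l|l]; first exact: (H' i j).
    by have [||] := H' j i _ l; rewrite 1?eq_sym//; [right|left].
  right; rewrite mulrCA ler_pM2l ?divr_gt0// !exprVn.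
  rewrite ler_pdivrMr ?exprn_gt0// mulrC ler_pdivlMr ?exprn_gt0//.
  exact: pow2_separated.
- exact: near_annuliE.
Qed.

(** Integrability of |x - z|^(q - n) at infinity when q < 0. *)
Lemma integral_kernel_far q : q < 0 -> exists2 K, 0 <= K & forall x r, 0 < r ->
  (\int[mu]_(t in outside_ball x r) (kernel x (q - n%:R) t)%:E <= (K * r `^ q)%:E)%E.
Proof.
move=> q0; pose th : R := 2 `^ q.
have th01 : 0 <= th < 1.
  rewrite powR_ge0/= /th -[q]opprK powRN invf_lt1 ?powR_gt0//.
  apply: (@le_lt_trans _ _ (1 `^ (- q))); first by rewrite powR1.
  by apply: gt0_ltr_powR; rewrite ?nnegrE//; lra.
exists (annulus_const q / (1 - th)).
  rewrite divr_ge0 ?annulus_const_ge0// subr_ge0 ltW//.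
  by case/andP: th01.
move=> x r r0.
have := @integral_annuli_le x q (fun j => r * 2 ^+ j) th (outside_ball x r).
rewrite expr0 mulr1 => H; apply: H => //.
- by move=> j; rewrite mulr_gt0 ?exprn_gt0.
- move=> j; rewrite powRM ?exprn_ge0 ?(ltW r0)//.
  congr (_ * _); rewrite -[2 ^+ j]powR_mulrn// -powRrM mulrC powRrM.
  by rewrite powR_mulrn// powR_ge0.
- move=> i j ij; wlog lt_ij : i j ij / (i < j)%N => [H'|].
    move: (ij); rewrite neq_ltn => /orP[l|l]; first exact: (H' i j).
    by have [||] := H' j i _ l; rewrite 1?eq_sym//; [right|left].
  by left; rewrite mulrCA ler_pM2l//; exact: pow2_separated.
- exact: far_annuliE.
Qed.

End annuli.

(** * Symmetrization of the singular integral *)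

Section symmetrization.
Variables (R : realType) (n : nat) (s : R).
Hypothesis s0 : 0 < s.
Local Notation TR := (measurableTypeR R).
Local Notation mu := (lebesgue_tuple R n).
Implicit Types (x y : 'rV[R]_n) (v : 'rV[R]_n -> R).

(** The symmetric second difference, with the sign of - v''. *)
Definition second_diff v x y : R := 2 * v x - v (x + y) - v (x - y).

Lemma frac_integrandE v x t :
  frac_integrand s v x t = (v x - v (point t)) * kernel x (- 2 * s - n%:R) t.
Proof. by rewrite /frac_integrand /kernel -powRN; congr (_ * _ `^ _); ring. Qed.

Lemma integrable_frac_integrand v x (B e : R) :
  continuous v -> (forall z, `|v z| <= B) -> 0 < e ->
  mu.-integrable (outside_ball x e) (EFin \o frac_integrand s v x).
Proof.
move=> cv vB e0.
have s2 : - 2 * s < 0 by move: s0; lra.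
have [K K0 HK] := @integral_kernel_far R n _ s2.
have B0 : 0 <= B by apply: le_trans (vB 0); exact: normr_ge0.
apply/integrableP; split.
  apply/measurable_EFinP; apply: measurable_funTS.
  exact: measurable_frac_integrand.
apply: (@le_lt_trans _ _ (\int[mu]_(t in outside_ball x e)
    ((2 * B)%:E * (kernel x (- 2 * s - n%:R) t)%:E))%E).
  apply: ge0_le_integral => //.
  - exact: measurable_outside_ball.
  - do 2 apply: measurableT_comp => //; apply: measurable_funTS.
    exact: measurable_frac_integrand.
  - apply: measurable_funeM; apply/measurable_EFinP; exact: measurable_kernel.
  - move=> t _; rewrite -EFinM lee_fin frac_integrandE normrM.
    rewrite [X in _ * X]ger0_norm ?kernel_ge0// ler_wpM2r ?kernel_ge0//.
    by rewrite (le_trans (ler_normB _ _))// mulrDl mul1r lerD.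
rewrite ge0_integralZl//.
- rewrite lte_mul_pinfty// ?lee_fin ?mulr_ge0//.
  by apply: le_lt_trans (HK x e e0) _; exact: ltry.
- exact: measurable_outside_ball.
- by apply/measurable_EFinP; exact: measurable_kernel.
- by move=> t _; rewrite lee_fin kernel_ge0.
- by rewrite lee_fin mulr_ge0.
Qed.

(** The sum of the singular integrand and of its image under the point
    reflection z |-> 2 x - z. It may be absolutely integrable near [x] when the
    singular integrand is not. *)
Definition sym_integrand v x (t : n.-tuple TR) : R :=
  second_diff v x (point t - x) * kernel x (- 2 * s - n%:R) t.

Lemma measurable_sym_integrand v x : continuous v ->
  measurable_fun setT (sym_integrand v x : _ -> TR).
Proof.
move=> cv; apply: measurable_funM; last exact: measurable_kernel.
have mcomp (w : 'rV[R]_n -> R) : continuous w ->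
    measurable_fun setT (fun t : n.-tuple TR => w (point t) : TR).
  by move=> cw; exact: measurable_fun_point.
rewrite /second_diff; apply: measurable_funB; first apply: measurable_funB => //.
- apply: (mcomp (fun z => v (x + (z - x)))) => z.
  by under eq_fun do rewrite subrKC; exact: cv.
- apply: (mcomp (v \o (fun z => x - (z - x)))) => z.
  apply: continuous_comp; last exact: cv.
  by apply: continuous_reflection.
Qed.

Lemma frac_truncated_sym v x (B e : R) :
  continuous v -> (forall z, `|v z| <= B) -> 0 < e ->
  frac_truncated s v x e =
  frac_const n s * (2^-1 * \int[mu]_(t in outside_ball x e) sym_integrand v x t).
Proof.
move=> cv vB e0; congr (_ * _).
pose D := outside_ball x e.
have mD : measurable D by exact: measurable_outside_ball.
have intf := integrable_frac_integrand x cv vB e0.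
have mf := measurable_frac_integrand s x cv.
have rE (t : n.-tuple TR) : x - (x + x - point t) = point t - x.
  by rewrite opprB addrCA opprD addNKr.
have DE : reflect (x + x) @^-1` D = D.
  apply/seteqP; split => t; rewrite /D /outside_ball/= point_reflect;
  by rewrite rE enormB.
have intf' : mu.-integrable D (EFin \o (frac_integrand s v x \o reflect (x + x))).
  rewrite -DE; apply: (@integrable_reflect _ _ _ _ (EFin \o frac_integrand s v x)) => //.
  exact/measurable_EFinP.
have E : \int[mu]_(t in D) sym_integrand v x t =
    \int[mu]_(t in D) (frac_integrand s v x t + frac_integrand s v x (reflect (x + x) t)).
  apply: eq_Rintegral => t _; rewrite !frac_integrandE /sym_integrand /second_diff.
  rewrite /kernel point_reflect.
  rewrite rE.
  rewrite (enormB (point t)) -mulrDl; congr (_ * _).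
  rewrite subrKC (_ : x - (point t - x) = x + x - point t).
    by ring.
  by rewrite opprB addrA.
have E2 := @Rintegral_reflect _ _ (x + x) _ _ mD mf intf.
rewrite DE in E2.
rewrite -/D E (RintegralD mD intf intf') /comp [X in _ + X](esym E2).
by move: (Rintegral _ _ _) => I; field.
Qed.

End symmetrization.

(** * The pointwise estimate *)

Section core.
Variables (R : realType) (n : nat) (s : R).
Local Notation TR := (measurableTypeR R).
Local Notation mu := (lebesgue_tuple R n).
Implicit Types (x y : 'rV[R]_n) (v : 'rV[R]_n -> R).

Lemma annulus_split x r : 0 < r ->
  outside_ball x 0 = annulus x 0 r `|` outside_ball x r.
Proof.
move=> r0; apply/seteqP; split => t; rewrite /annulus /outside_ball/=.
  by move=> ->; case: leP => _; [left|right].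
by case=> [/andP[]//|]; exact: lt_trans.
Qed.

Lemma annulus_outside_disjoint x r (A B : set (n.-tuple TR)) :
  A `<=` annulus x 0 r -> B `<=` outside_ball x r -> [disjoint A & B].
Proof.
move=> hA hB; apply/disj_setPS => t [/hA /andP[_ h] /hB].
by rewrite /outside_ball/= ltNge h.
Qed.

(** A pointwise power bound on the second difference bounds the integral of
    the symmetrized integrand by that of a kernel. *)
Lemma integral_sym_le v x (A q : R) (D : set (n.-tuple TR)) (M : \bar R) :
  continuous v -> measurable D -> 0 <= A -> D `<=` outside_ball x 0 ->
  (forall t, D t -> `|second_diff v x (point t - x)| <= A * enorm (point t - x) `^ q) ->
  (\int[mu]_(t in D) (kernel x (q - 2 * s - n%:R) t)%:E <= M)%E ->
  (\int[mu]_(t in D) `|(sym_integrand s v x t)%:E| <= A%:E * M)%E.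
Proof.
move=> cv mD A0 D0 dA kM.
apply: (@le_trans _ _ (\int[mu]_(t in D) (A%:E * (kernel x (q - 2 * s - n%:R) t)%:E))%E).
  apply: ge0_le_integral.
  - exact: mD.
  - by move=> t _; exact: abse_ge0.
  - apply: measurableT_comp => //; apply/measurable_EFinP; apply: measurable_funTS.
    exact: measurable_sym_integrand.
  - by apply: measurable_funeM; apply/measurable_EFinP; exact: measurable_kernel.
  - move=> t Dt; rewrite /= -EFinM lee_fin normrM.
    rewrite [X in _ * X]ger0_norm ?kernel_ge0//.
    rewrite (_ : q - 2 * s - n%:R = q + (- 2 * s - n%:R)); last by ring.
    rewrite /kernel powRD; last first.
      by rewrite (gt_eqF (D0 _ Dt)) implybT.
    by rewrite mulrA ler_wpM2r ?powR_ge0// [enorm (x - _)]enormB; exact: dA.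
rewrite ge0_integralZl//.
- by rewrite lee_wpmul2l ?lee_fin.
- by apply/measurable_EFinP; exact: measurable_kernel.
- by move=> t _; rewrite lee_fin kernel_ge0.
Qed.

(** The pointwise estimate behind everything, for bounded continuous [v]: if the
    second differences of [v] at [x] are O(|y|^g) for |y| <= r with g > 2s, and
    O(|y|^b) for |y| > r with b < 2s, then the singular integral at [x] converges and is controlled by
    the corresponding powers of [r]. *)
Lemma frac_laplacian_pointwise (g b : R) : 0 < s -> b < 2 * s < g ->
  exists2 C, 0 <= C & forall v x (B r A1 A2 : R),
    continuous v -> (forall z, `|v z| <= B) -> 0 < r -> 0 <= A1 -> 0 <= A2 ->
    (forall y, enorm y <= r -> `|second_diff v x y| <= A1 * enorm y `^ g) ->
    (forall y, r < enorm y -> `|second_diff v x y| <= A2 * enorm y `^ b) ->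
    cvg (frac_truncated s v x e @[e --> 0^'+]) /\
    `|frac_laplacian s v x| <= C * (A1 * r `^ (g - 2 * s) + A2 * r `^ (b - 2 * s)).
Proof.
move=> s0 /andP[bs sg].
have g0 : 0 < g - 2 * s by lra.
have b0 : b - 2 * s < 0 by lra.
have [K1 K10 HK1] := @integral_kernel_near R n _ g0.
have [K2 K20 HK2] := @integral_kernel_far R n _ b0.
pose c := `|frac_const n s| * 2^-1.
have c0 : 0 <= c by rewrite mulr_ge0.
exists (c * (K1 + K2)); first by rewrite mulr_ge0// addr_ge0.
move=> v x B r A1 A2 cv vB r0 A10 A20 dA1 dA2.
pose G := sym_integrand s v x.
have mG : measurable_fun setT (G : _ -> TR) by exact: measurable_sym_integrand.
have mO e := measurable_outside_ball x e.
have mA e := measurable_annulus x 0 e.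
have O0 e : 0 < e -> outside_ball x e `<=` outside_ball x 0.
  by move=> e0 t; rewrite /outside_ball/=; exact: lt_trans.
have A0 e : annulus x 0 e `<=` outside_ball x 0 by move=> t /andP[].
have near e : 0 < e <= r ->
    (\int[mu]_(t in annulus x 0 e) `|(G t)%:E| <= (A1 * (K1 * e `^ (g - 2 * s)))%:E)%E.
  move=> /andP[e0 er]; rewrite EFinM.
  apply: (@integral_sym_le v x A1 g) => //; last exact: HK1.
  move=> t /andP[_ h]; apply: dA1.
  by rewrite enormB (le_trans h).
have far : (\int[mu]_(t in outside_ball x r) `|(G t)%:E| <=
    (A2 * (K2 * r `^ (b - 2 * s)))%:E)%E.
  rewrite EFinM; apply: (@integral_sym_le v x A2 b) => //; first exact: O0.
    by move=> t h; apply: dA2; rewrite enormB.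
  exact: HK2.
have intG_of D M : measurable D -> (\int[mu]_(t in D) `|(G t)%:E| <= M%:E)%E ->
    mu.-integrable D (EFin \o G).
  move=> mD h; apply/integrableP; split.
    by apply/measurable_EFinP; exact: measurable_funTS.
  by apply: le_lt_trans h _; exact: ltry.
have abs_of D M : measurable D -> (\int[mu]_(t in D) `|(G t)%:E| <= M%:E)%E ->
    `|\int[mu]_(t in D) G t| <= M.
  move=> mD h; rewrite -lee_fin EFin_normr_Rintegral//; last exact: intG_of h.
  apply: le_trans h; apply: le_abse_integral => //.
  by apply/measurable_EFinP; exact: measurable_funTS.
have intA e : 0 < e <= r -> mu.-integrable (annulus x 0 e) (EFin \o G).
  by move=> er; exact: intG_of (near e er).
have r0r : 0 < r <= r by rewrite r0 lexx.
have intO0 : mu.-integrable (outside_ball x 0) (EFin \o G).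
  rewrite (annulus_split x r0); apply/integrableP; split.
    by apply/measurable_EFinP; exact: measurable_funTS.
  rewrite ge0_integral_setU//.
  - apply: lte_add_pinfty; first by apply: le_lt_trans (near r r0r) _; exact: ltry.
    by apply: le_lt_trans far _; exact: ltry.
  - by do 2 apply: measurableT_comp => //; exact: measurable_funTS.
  - exact: (@annulus_outside_disjoint x r).
have intO e : 0 < e -> mu.-integrable (outside_ball x e) (EFin \o G).
  by move=> e0; apply: integrableS intO0 => //; exact: O0.
have splitO e : 0 < e -> \int[mu]_(t in outside_ball x 0) G t =
    \int[mu]_(t in annulus x 0 e) G t + \int[mu]_(t in outside_ball x e) G t.
  move=> e0; rewrite (annulus_split x e0) Rintegral_setU//.
    by rewrite -(annulus_split x e0).
  exact: (@annulus_outside_disjoint x e).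
(* [L] is the limit: the truncated integral at radius e differs from it by a
   constant times the integral of [G] over the punctured ball of radius e. *)
pose L := frac_const n s * (2^-1 * \int[mu]_(t in outside_ball x 0) G t).
have dist e : 0 < e <= r ->
    `|L - frac_truncated s v x e| <= c * (A1 * (K1 * e `^ (g - 2 * s))).
  move=> /andP[e0 er]; rewrite (frac_truncated_sym s0 x cv vB e0) -/G /L (splitO _ e0).
  rewrite -mulrBr -mulrBr addrK mulrA normrM /c.
  rewrite [X in X * _ <= _]normrM (ger0_norm (_ : 0 <= 2^-1))// ler_wpM2l//.
  by apply: abs_of => //; apply: near; rewrite e0.
have cvgL : frac_truncated s v x e @[e --> 0^'+] --> L.
  apply/cvgrPdist_le => /= eps eps0.
  pose M := c * (A1 * K1) + 1.
  have M0 : 0 < M by rewrite ltr_wpDl// !mulr_ge0.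
  (* [d] solves M * d ^ (g - 2 s) = eps. *)
  pose d := (eps / M) `^ (g - 2 * s)^-1.
  have d0 : 0 < d by rewrite powR_gt0// divr_gt0.
  near=> e.
  have e0 : 0 < e by [].
  have er : e <= r by near: e; exact: nbhs_right_le.
  have ed : e <= d by near: e; exact: nbhs_right_le.
  apply: le_trans (dist e _) _; first by rewrite e0.
  have h : e `^ (g - 2 * s) <= eps / M.
    have <- : d `^ (g - 2 * s) = eps / M.
      by rewrite /d -powRrM mulVf ?gt_eqF// powRr1// ltW// divr_gt0.
    by apply: (ge0_ler_powR (ltW g0)); rewrite ?nnegrE// ltW.
  apply: (@le_trans _ _ (M * (eps / M))); last first.
    by rewrite mulrCA divff ?mulr1// gt_eqF.
  apply: (@le_trans _ _ (M * e `^ (g - 2 * s))); last by rewrite ler_wpM2l// ltW.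
  have : 0 <= e `^ (g - 2 * s) by exact: powR_ge0.
  by rewrite /M; lra.
split; first by apply/cvg_ex; exists L.
rewrite /frac_laplacian (cvg_lim _ cvgL)//.
rewrite /L mulrA normrM [X in X * _ <= _]normrM (ger0_norm (_ : 0 <= 2^-1))// -/c.
rewrite -[leRHS]mulrA ler_wpM2l//.
rewrite (splitO _ r0) (le_trans (ler_normD _ _))//.
apply: (@le_trans _ _ (A1 * (K1 * r `^ (g - 2 * s)) + A2 * (K2 * r `^ (b - 2 * s)))).
  by apply: lerD; apply: abs_of => //; exact: near.
have p1 : 0 <= r `^ (g - 2 * s) by exact: powR_ge0.
have p2 : 0 <= r `^ (b - 2 * s) by exact: powR_ge0.
have : 0 <= K2 * (A1 * r `^ (g - 2 * s)) by rewrite !mulr_ge0.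
have : 0 <= K1 * (A2 * r `^ (b - 2 * s)) by rewrite !mulr_ge0.
by lra.
Unshelve. all: by end_near. Qed.

End core.

(** * Mean value theorem and mixed derivatives *)

Section line_calculus.
Variable R : realType.

(** The mean value theorem on a segment from 0 of either orientation. *)
Lemma MVT0 (f df : R -> R) (h : R) : (forall t : R, is_derive t (1 : R) f (df t)) ->
  exists2 c, `|c| <= `|h| & f h - f 0 = h * df c.
Proof.
move=> fdf.
have fc : continuous f.
  move=> t; apply: differentiable_continuous; apply/derivable1_diffP.
  exact: (@ex_derive _ _ _ _ _ _ _ (fdf t)).
have fcw a b : {within `[a, b], continuous f} by exact: continuous_subspaceT.
have [h0|h0] := leP 0 h.
  have [c] := MVT_segment h0 (fun t _ => fdf t) (fcw 0 h).
  rewrite in_itv/= => /andP[c0 ch] ->; exists c; last by rewrite subr0 mulrC.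
  by rewrite !ger0_norm.
have [c] := MVT_segment (ltW h0) (fun t _ => fdf t) (fcw h 0).
rewrite in_itv/= => /andP[hc c0] E; exists c.
  by rewrite (ltr0_norm h0) ler0_norm// lerN2.
by rewrite -opprB E sub0r mulrN opprK mulrC.
Qed.

Variable V : normedModType R.
Implicit Types (u : V -> R) (z e : V).

(** Directional derivatives are ordinary derivatives along lines. *)
Lemma is_derive_line u z e (t : R) : derivable u (z + t *: e) e ->
  is_derive t (1 : R) (fun t : R => u (z + t *: e)) ('D_e u (z + t *: e)).
Proof.
have E : (fun h : R => h^-1 *:
    (((fun t => u (z + t *: e)) \o shift t) (h *: (1 : R)) - u (z + t *: e)))
    = (fun h => h^-1 *: ((u \o shift (z + t *: e)) (h *: e) - u (z + t *: e))).
  apply/funext => h /=; congr (_ *: (u _ - _)).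
  by rewrite [h *: _]mulr1 scalerDl addrCA.
by move=> du; apply: DeriveDef; rewrite /derivable /derive E.
Qed.

Lemma is_derive_translate u h z e : derivable u (z + h) e ->
  is_derive z e (fun z => u (z + h)) ('D_e u (z + h)).
Proof.
have E : (fun t : R => t^-1 *: (((fun z => u (z + h)) \o shift z) (t *: e) - u (z + h)))
    = (fun t => t^-1 *: ((u \o shift (z + h)) (t *: e) - u (z + h))).
  by apply/funext => t /=; rewrite addrA.
by move=> du; apply: DeriveDef; rewrite /derivable /derive E.
Qed.

Lemma MVT_line u z e (h : R) : (forall z, derivable u z e) ->
  exists2 c : R, `|c| <= `|h| & u (z + h *: e) - u z = h * 'D_e u (z + c *: e).
Proof.
move=> du; have [c ch] := MVT0 h (fun t => @is_derive_line u z e t (du _)).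
by rewrite scale0r addr0 => E; exists c.
Qed.

(** The mixed second difference with equal increments is the square of the
    increment times a value of the iterated derivative nearby. *)
Lemma mixed_difference u x e f (h : R) : 0 < h ->
  (forall z, derivable u z e) -> (forall z, derivable ('D_e u) z f) ->
  exists p, `|x - p| <= h * (`|e| + `|f|) /\
    u (x + h *: f + h *: e) - u (x + h *: e) - (u (x + h *: f) - u x) =
      h * (h * 'D_f ('D_e u) p).
Proof.
move=> h0 de dfe; pose F z := u (z + h *: f) - u z.
have dF z : is_derive z e F ('D_e u (z + h *: f) - 'D_e u z).
  have H1 := is_derive_translate (de (z + h *: f)).
  have H2 : is_derive z e u ('D_e u z) by apply: DeriveDef.
  exact: (is_deriveB H1 H2).
have [c ch E] := MVT_line x h (fun z => @ex_derive _ _ _ _ _ _ _ (dF z)).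
have [c' c'h E'] := MVT_line (x + c *: e) h dfe.
have hE : `|h| = h by exact: gtr0_norm.
rewrite hE in ch c'h.
exists (x + c *: e + c' *: f); split.
  rewrite -addrA opprD addrA subrr sub0r normrN.
  by rewrite (le_trans (ler_normD _ _))// !normrZ mulrDr lerD// ler_wpM2r.
rewrite -E' -[X in h * X](@derive_val _ _ _ _ _ _ _ (dF (x + c *: e))) -E /F.
by rewrite [x + h *: e + _]addrAC.
Qed.

(** Two continuous functions agree at [x] if they share a value, taken at possibly
    different points, arbitrarily close to [x]. *)
Lemma continuous_eq_of_close (A B : V -> R) x (N : R) :
  continuous A -> continuous B -> 0 <= N ->
  (forall h : R, 0 < h -> exists p q, [/\ `|x - p| <= h * N, `|x - q| <= h * N & A p = B q]) ->
  A x = B x.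
Proof.
move=> cA cB N0 H; apply/eqP; rewrite -subr_eq0 -normr_le0.
apply/ler_addgt0Pl => eps eps0; rewrite addr0.
have eps20 : 0 < eps / 2 by rewrite divr_gt0.
have /nbhs_ballP[d1 /= d10 H1] : \forall z \near x, `|A x - A z| <= eps / 2.
  by move: (cA x) => /(@cvgrPdist_le _ _ _ (nbhs x)) /(_ _ eps20).
have /nbhs_ballP[d2 /= d20 H2] : \forall z \near x, `|B x - B z| <= eps / 2.
  by move: (cB x) => /(@cvgrPdist_le _ _ _ (nbhs x)) /(_ _ eps20).
pose d := Num.min d1 d2; have d0 : 0 < d by rewrite lt_min d10.
have N1 : 0 < N + 1 by lra.
have h0 : 0 < d / (N + 1) by rewrite divr_gt0.
have hN : d / (N + 1) * N < d.
  by rewrite mulrAC ltr_pdivrMr// ltr_pM2l//; lra.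
have [p [q [xp xq pq]]] := H _ h0.
have Bp : `|A x - A p| <= eps / 2.
  apply: H1; rewrite -ball_normE/=; apply: le_lt_trans xp _.
  by apply: (lt_le_trans hN); rewrite ge_min lexx.
have Bq : `|B x - B q| <= eps / 2.
  apply: H2; rewrite -ball_normE/=; apply: le_lt_trans xq _.
  by apply: (lt_le_trans hN); rewrite ge_min lexx orbT.
move: Bp Bq; rewrite pq !ler_norml => /andP[? ?] /andP[? ?].
by apply/andP; split; lra.
Qed.

(** Symmetry of mixed derivatives, for continuous mixed derivatives. *)
Lemma derive_comm u e f :
  (forall z, derivable u z e) -> (forall z, derivable u z f) ->
  (forall z, derivable ('D_e u) z f) -> (forall z, derivable ('D_f u) z e) ->
  continuous ('D_f ('D_e u)) -> continuous ('D_e ('D_f u)) ->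
  'D_f ('D_e u) = 'D_e ('D_f u).
Proof.
move=> de df dfe def cfe cef; apply/funext => x.
apply: (continuous_eq_of_close (N := `|e| + `|f|) cfe cef) => [|h h0].
  exact: addr_ge0.
have [p [xp Ep]] := mixed_difference x h0 de dfe.
have [q [xq Eq]] := mixed_difference x h0 df def.
exists p, q; split; [exact: xp|by rewrite [`|e| + _]addrC; exact: xq|].
apply: (mulfI (lt0r_neq0 h0)); apply: (mulfI (lt0r_neq0 h0)).
have E : u (x + h *: f + h *: e) = u (x + h *: e + h *: f) by rewrite addrAC.
apply: etrans (esym Ep) (etrans _ Eq); rewrite E.
by rewrite addrAC opprB addrA [LHS]addrAC; ring.
Qed.

Lemma cvg_powR_norm0 (p : R) : 0 < p -> `|h| `^ p @[h --> (0 : R)^'] --> (0 : R).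
Proof.
move=> p0; apply/cvgrPdist_le => /= eps eps0.
have d0 : 0 < eps `^ p^-1 by rewrite powR_gt0.
near=> h; rewrite sub0r normrN ger0_norm ?powR_ge0//.
rewrite -[leRHS](_ : (eps `^ p^-1) `^ p = eps); last first.
  by rewrite -powRrM mulVf ?gt_eqF// powRr1// ltW.
apply: (ge0_ler_powR (ltW p0)); rewrite ?nnegrE// ?(ltW d0)//.
near: h; apply: (@nbhs_dnbhs _ (0 : R)).
by apply/nbhs_ballP; exists (eps `^ p^-1) => //= h; rewrite /ball/= sub0r normrN; exact: ltW.
Unshelve. all: by end_near. Qed.

End line_calculus.

(** * The operator on bounded continuous functions *)

Section operator.
Variables (R : realType) (n : nat) (s : R).
Hypothesis s0 : 0 < s.
Local Notation TR := (measurableTypeR R).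
Local Notation mu := (lebesgue_tuple R n).
Implicit Types (x y z h : 'rV[R]_n) (v w : 'rV[R]_n -> R).

(** Bounded continuous functions with a convergent singular integral at every
    point: the common domain on which linearity and translation invariance are
    proved. *)
Record admissible v : Prop := Admissible {
  adm_cont : continuous v;
  adm_bounded : exists B, forall z, `|v z| <= B;
  adm_cvg : forall x, cvg (frac_truncated s v x e @[e --> 0^'+]) }.

Lemma admissible_integrable v x e : admissible v -> 0 < e ->
  mu.-integrable (outside_ball x e) (EFin \o frac_integrand s v x).
Proof.
by move=> [cv [B vB] _]; exact: integrable_frac_integrand.
Qed.

Lemma admissible_has_frac_laplacian v : admissible v -> has_frac_laplacian s v.
Proof.
move=> av x; split; last exact: adm_cvg.
by move=> e e0; exact: admissible_integrable.
Qed.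

Lemma frac_truncated_translate v x h e : admissible v -> 0 < e ->
  frac_truncated s (fun z => v (z + h)) x e = frac_truncated s v (x + h) e.
Proof.
move=> av e0; rewrite /frac_truncated.
apply: (congr1 ( *%R (frac_const n s))).
have E := @Rintegral_translate R n h (outside_ball (x + h) e) (frac_integrand s v (x + h))
  (measurable_outside_ball _ _) (measurable_frac_integrand s _ (adm_cont av))
  (admissible_integrable (x + h) av e0).
have DE : translate h @^-1` outside_ball (x + h) e = outside_ball x e.
  apply/seteqP; split => t; rewrite /outside_ball/= point_translate;
  by rewrite [point t + h]addrC addrKA.
rewrite DE in E; apply: etrans (esym E).
apply: eq_Rintegral => t _; rewrite /frac_integrand point_translate.
have -> : x + h - (point t + h) = x - point t by rewrite [point t + h]addrC addrKA.
by [].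
Qed.

Lemma cvg_at_right0_eq (f f' : R -> R) (l : R) : (forall e, 0 < e -> f e = f' e) ->
  f e @[e --> 0^'+] --> l -> f' e @[e --> 0^'+] --> l.
Proof.
move=> ff'; apply: cvg_trans; apply: near_eq_cvg.
by near=> e; apply: ff'.
Unshelve. all: by end_near. Qed.

Lemma admissibleP v x : admissible v ->
  frac_truncated s v x e @[e --> 0^'+] --> frac_laplacian s v x.
Proof. by move=> /adm_cvg; exact. Qed.

Lemma admissible_translate v h : admissible v ->
  admissible (fun z => v (z + h)) /\
  forall x, frac_laplacian s (fun z => v (z + h)) x = frac_laplacian s v (x + h).
Proof.
move=> av.
have cvgx x : frac_truncated s (fun z => v (z + h)) x e @[e --> 0^'+]
    --> frac_laplacian s v (x + h).
  apply: (@cvg_at_right0_eq (frac_truncated s v (x + h))); last exact: admissibleP.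
  move=> e e0.
  by rewrite frac_truncated_translate.
split; last by move=> x; apply: cvg_lim (cvgx x).
split.
- move=> z; apply: (@continuous_comp _ _ _ (fun z => z + h) v).
    exact: continuous_shift.
  exact: (adm_cont av).
- by have [B vB] := adm_bounded av; exists B.
- by move=> x; apply/cvg_ex; eexists; exact: cvgx.
Qed.

Lemma admissibleB v w : admissible v -> admissible w ->
  admissible (fun z => v z - w z) /\
  forall x, frac_laplacian s (fun z => v z - w z) x =
    frac_laplacian s v x - frac_laplacian s w x.
Proof.
move=> av aw.
have cvgx x : frac_truncated s (fun z => v z - w z) x e @[e --> 0^'+]
    --> frac_laplacian s v x - frac_laplacian s w x.
  apply: cvg_at_right0_eq (cvgB (@admissibleP _ x av) (@admissibleP _ x aw)).
  move=> e e0; transitivity (frac_truncated s v x e - frac_truncated s w x e).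
    by [].
  rewrite /frac_truncated -mulrBr.
  apply: (congr1 ( *%R (frac_const n s))).
  have := RintegralB (measurable_outside_ball x e)
    (admissible_integrable x av e0) (admissible_integrable x aw e0).
  move=> /esym ->; apply: eq_Rintegral => t _.
  by rewrite /frac_integrand -mulrBl; congr (_ * _); ring.
split; last by move=> x; apply: cvg_lim (cvgx x).
split.
- by move=> z; apply: (@cvgB _ _ _ (nbhs z) _ v w); [exact: (adm_cont av)|exact: (adm_cont aw)].
- have [B vB] := adm_bounded av; have [B' wB] := adm_bounded aw.
  by exists (B + B') => z; rewrite (le_trans (ler_normB _ _))// lerD.
- by move=> x; apply/cvg_ex; eexists; exact: cvgx.
Qed.

Lemma admissibleZ (c : R) v : admissible v ->
  admissible (fun z => c * v z) /\
  forall x, frac_laplacian s (fun z => c * v z) x = c * frac_laplacian s v x.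
Proof.
move=> av.
have cvgx x : frac_truncated s (fun z => c * v z) x e @[e --> 0^'+]
    --> c * frac_laplacian s v x.
  apply: cvg_at_right0_eq (cvgMl_tmp (@admissibleP _ x av)).
  move=> e e0; rewrite /frac_truncated mulrCA.
  apply: (congr1 ( *%R (frac_const n s))).
  have := RintegralZl c (measurable_outside_ball x e) (admissible_integrable x av e0).
  move=> /esym ->; apply: eq_Rintegral => t _.
  by rewrite /frac_integrand mulrA; congr (_ * _); ring.
split; last by move=> x; apply: cvg_lim (cvgx x).
split.
- by move=> z; apply: (@cvgMl_tmp _ _ (nbhs z) _ v); exact: (adm_cont av).
- have [B vB] := adm_bounded av; exists (`|c| * B) => z.
  by rewrite normrM ler_wpM2l.
- by move=> x; apply/cvg_ex; eexists; exact: cvgx.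
Qed.

(** A Zygmund-type condition of exponent [g]. *)
Definition second_diff_bound (g A : R) v : Prop :=
  forall x y, `|second_diff v x y| <= A * enorm y `^ g.

Lemma second_diff_le4 v x y (B : R) : (forall z, `|v z| <= B) ->
  `|second_diff v x y| <= 4 * B.
Proof.
move=> vB; rewrite /second_diff.
have := vB x; have := vB (x + y); have := vB (x - y).
by rewrite !ler_norml => /andP[? ?] /andP[? ?] /andP[? ?]; apply/andP; split; lra.
Qed.

Lemma second_diffB v w x y :
  second_diff (fun z => v z - w z) x y = second_diff v x y - second_diff w x y.
Proof. by rewrite /second_diff; ring. Qed.

Lemma second_diffZ c v x y :
  second_diff (fun z => c * v z) x y = c * second_diff v x y.
Proof. by rewrite /second_diff; ring. Qed.

Lemma second_diff_translate v h x y :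
  second_diff (fun z => v (z + h)) x y = second_diff v (x + h) y.
Proof. by rewrite /second_diff ![x + _ + h]addrAC. Qed.

Variables (g : R).
Hypothesis sg : 2 * s < g.

(** The pointwise estimate with the trivial bound 4 sup |v| far away. *)
Lemma frac_laplacian_bound : exists2 C : R, 0 <= C & forall v (A B r : R),
  continuous v -> (forall z, `|v z| <= B) -> 0 < r -> 0 <= A ->
  second_diff_bound g A v ->
  admissible v /\
  forall x, `|frac_laplacian s v x| <= C * (A * r `^ (g - 2 * s) + B * r `^ (- 2 * s)).
Proof.
have s2 : 0 < 2 * s < g by rewrite mulr_gt0.
have [C C0 HC] := @frac_laplacian_pointwise R n s g 0 s0 s2.
exists (4 * C) => [|v A B r cv vB r0 A0 dA]; first by rewrite mulr_ge0.
have B0 : 0 <= B by apply: le_trans (vB 0); exact: normr_ge0.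
have H x : cvg (frac_truncated s v x e @[e --> 0^'+]) /\
    `|frac_laplacian s v x| <= C * (A * r `^ (g - 2 * s) + 4 * B * r `^ (0 - 2 * s)).
  apply: (HC v x B r A (4 * B)) => //; first by rewrite mulr_ge0.
  by move=> y _; rewrite powRr0 mulr1; exact: second_diff_le4.
split=> [|x]; first by split=> //; [exists B|move=> x; have [] := H x].
have [_ h] := H x; apply: le_trans h _.
rewrite [4 * C]mulrC -[leRHS]mulrA ler_wpM2l//.
rewrite (_ : 0 - 2 * s = - 2 * s); last by ring.
have : 0 <= A * r `^ (g - 2 * s) by rewrite mulr_ge0 ?powR_ge0.
by lra.
Qed.

Lemma frac_laplacian_sup : exists2 C : R, 0 <= C & forall v (A B : R),
  continuous v -> (forall z, `|v z| <= B) -> 0 <= A ->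
  second_diff_bound g A v ->
  admissible v /\ forall x, `|frac_laplacian s v x| <= C * (A + B).
Proof.
have [C C0 HC] := frac_laplacian_bound; exists C => // v A B cv vB A0 dA.
have [av H] := HC v A B 1 cv vB ltr01 A0 dA; split => // x.
by have := H x; rewrite !powR1 !mulr1.
Qed.

(** Hoelder continuity: compare [v] with its translate by h, splitting the
    integral at radius |h|. *)
Lemma frac_laplacian_holder (b : R) : b < 2 * s ->
  exists2 C : R, 0 <= C & forall v (A A' : R), admissible v -> 0 <= A -> 0 <= A' ->
  second_diff_bound g A v ->
  (forall x h y, `|second_diff v (x + h) y - second_diff v x y|
     <= A' * enorm h `^ (g - b) * enorm y `^ b) ->
  forall x z, `|frac_laplacian s v x - frac_laplacian s v z|
     <= C * (A + A') * enorm (x - z) `^ (g - 2 * s).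
Proof.
move=> bs; have s2 : b < 2 * s < g by rewrite bs.
have [C C0 HC] := @frac_laplacian_pointwise R n s g b s0 s2.
exists (2 * C) => [|v A A' av A0 A'0 dA dA' x z]; first by rewrite mulr_ge0.
have [->|xz] := eqVneq x z.
  by rewrite subrr normr0 !mulr_ge0 ?addr_ge0 ?powR_ge0.
pose h := x - z; have h0 : 0 < enorm h by rewrite enorm_gt0 subr_eq0.
have [ath Eth] := admissible_translate h av.
have [aw Ew] := admissibleB ath av.
have -> : frac_laplacian s v x - frac_laplacian s v z =
    frac_laplacian s (fun z => v (z + h) - v z) z.
  by rewrite Ew Eth /h subrKC.
have [B wB] := adm_bounded aw.
have dw y : second_diff (fun z => v (z + h) - v z) z y =
    second_diff v (z + h) y - second_diff v z y.
  by rewrite second_diffB second_diff_translate.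
have [||y _|y _|_ H] := HC _ z B (enorm h) (2 * A) (A' * enorm h `^ (g - b))
  (adm_cont aw) wB h0.
- by rewrite mulr_ge0.
- by rewrite mulr_ge0 ?powR_ge0.
- rewrite dw (le_trans (ler_normB _ _))// -mulrA mulrDl mul1r lerD//.
- by rewrite dw.
apply: le_trans H _; rewrite -/h.
rewrite -[A' * _ * _]mulrA -powRD; last by rewrite (gt_eqF h0) implybT.
rewrite (_ : g - b + (b - 2 * s) = g - 2 * s); last by ring.
have : 0 <= C * (A' * enorm h `^ (g - 2 * s)) by rewrite !mulr_ge0 ?powR_ge0.
by lra.
Qed.

(** Differentiation commutes with the operator. The second differences of the
    difference quotient are, by the mean value theorem, second differences of
    the derivative, hence bounded uniformly; the quotient itself converges
    uniformly. Splitting at a radius that tends to 0 slowly with the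
    increment concludes. *)
Lemma frac_laplacian_derive (v : 'rV[R]_n -> R) (i : 'I_n) (A B a : R) :
  0 < a -> s < 1 -> 0 <= A -> 0 <= B ->
  admissible v -> (forall z, derivable v z (basis_vec R i)) ->
  let w := fun z => 'D_(basis_vec R i) v z in
  admissible w -> second_diff_bound g A w ->
  (forall z z', `|w z - w z'| <= B * enorm (z - z') `^ a) ->
  forall x, is_derive x (basis_vec R i) (frac_laplacian s v) (frac_laplacian s w x).
Proof.
move=> a0 s1 A0 B0 av dv w aw dA wB x; set e := basis_vec R i.
have [C C0 HC] := frac_laplacian_bound.
pose q (h : R) := fun z => h^-1 * (v (z + h *: e) - v z) - w z.
have aq (h : R) : admissible (q h) /\ forall x, frac_laplacian s (q h) x =
    h^-1 * (frac_laplacian s v (x + h *: e) - frac_laplacian s v x) - frac_laplacian s w x.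
  have [a1 E1] := admissible_translate (h *: e) av.
  have [a2 E2] := admissibleB a1 av.
  have [a3 E3] := admissibleZ h^-1 a2.
  have [a4 E4] := admissibleB a3 aw.
  by split=> [|z]; [exact: a4|rewrite E4 E3 E2 E1].
have qB (h : R) z : h != 0 -> `|q h z| <= B * `|h| `^ a.
  move=> h0; have [c ch E] := MVT_line z h dv.
  rewrite /q E mulKf// (le_trans (wB _ _))// ler_wpM2l//.
  apply: (ge0_ler_powR (ltW a0)); rewrite ?nnegrE ?enorm_ge0//.
  by rewrite addrAC subrr add0r enorm_basis.
have qA (h : R) : h != 0 -> second_diff_bound g (2 * A) (q h).
  move=> h0 z y.
  pose f t := second_diff v (z + t *: e) y.
  have df (t : R) : is_derive t (1 : R) f (second_diff w (z + t *: e) y).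
    have dl z' := is_derive_line (dv (z' + t *: e)).
    have H1 := dl z; have H2 := dl (z + y); have H3 := dl (z - y).
    have -> : f = 2 \*: (fun t : R => v (z + t *: e)) - (fun t : R => v (z + y + t *: e))
        - (fun t : R => v (z - y + t *: e)).
      by apply/funext => t'; rewrite /f /second_diff ![z + _ *: _ + _]addrAC.
    rewrite /second_diff ![z + _ *: _ + _]addrAC.
    apply: is_deriveB.
  have [c ch E] := MVT0 h df.
  rewrite /q second_diffB second_diffZ second_diffB second_diff_translate.
  rewrite -[second_diff v z y](_ : f 0 = _); last by rewrite /f scale0r addr0.
  rewrite E mulKf// (le_trans (ler_normB _ _))// -mulrA mulrDl mul1r lerD//.
(* The radius is |h| ^ (a / 4): the exponent a / 4 is small enough for
   |h| ^ a * r ^ (- 2 s) to tend to 0, since s < 1. *)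
pose k1 := a / 4 * (g - 2 * s); pose k2 := a + a / 4 * (- 2 * s).
have k10 : 0 < k1 by rewrite mulr_gt0 ?divr_gt0// subr_gt0.
have k20 : 0 < k2.
  have : a * s < a by rewrite gtr_pMr.
  by rewrite /k2; lra.
have key (h : R) : h != 0 ->
    `|frac_laplacian s w x - h^-1 * (frac_laplacian s v (x + h *: e) - frac_laplacian s v x)|
    <= C * (2 * A * `|h| `^ k1 + B * `|h| `^ k2).
  move=> h0; have [adq Eq] := aq h.
  have r0 : 0 < `|h| `^ (a / 4) by rewrite powR_gt0// normr_gt0.
  have [|_ H] := HC (q h) (2 * A) (B * `|h| `^ a) _ (adm_cont adq)
    (fun z => qB h z h0) r0 _ (qA h h0); first by rewrite mulr_ge0.
  have := H x; rewrite Eq distrC -!powRrM -[B * _ * _]mulrA -powRD//.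
  by rewrite normr_eq0 h0 implybT.
have cvgD : h^-1 *: ((frac_laplacian s v \o shift x) (h *: e) - frac_laplacian s v x)
    @[h --> (0 : R)^'] --> frac_laplacian s w x.
  apply/cvgrPdist_le => /= eps eps0.
  have : C * (2 * A * `|h| `^ k1 + B * `|h| `^ k2) @[h --> (0 : R)^']
      --> C * (2 * A * 0 + B * 0).
    by apply: cvgMl_tmp; apply: cvgD; apply: cvgMl_tmp; exact: cvg_powR_norm0.
  rewrite !mulr0 addr0 mulr0 => /cvgrPdist_le /(_ _ eps0) /= near_eps.
  near=> h.
  have h0 : h != 0 by near: h; exact: nbhs_dnbhs_neq.
  rewrite [_ + x]addrC; apply: le_trans (key h h0) _.
  have : `|0 - C * (2 * A * `|h| `^ k1 + B * `|h| `^ k2)| <= eps by near: h.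
  by rewrite sub0r normrN; apply: le_trans; exact: ler_norm.
apply: DeriveDef; first by apply/cvg_ex; eexists; exact: cvgD.
exact: cvg_lim cvgD.
Unshelve. all: by end_near. Qed.

End operator.

(** * Hoelder conditions and second differences *)

Section gradient_estimates.
Variables (R : realType) (n : nat).
Implicit Types (x y z h : 'rV[R]_n) (v w : 'rV[R]_n -> R).
Local Notation e_ := (basis_vec R).

(** [v] is Hoelder continuous of exponent [a] with constant [M]. *)
Definition holder_bound (a M : R) v : Prop :=
  forall x z, `|v x - v z| <= M * enorm (x - z) `^ a.

Lemma holder_continuous (a M : R) v : 0 < a -> 0 <= M -> holder_bound a M v ->
  continuous v.
Proof.
move=> a0 M0 hv x; apply/(@cvgrPdist_le _ _ _ (nbhs x)) => /= eps eps0.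
have M1 : 0 < M + 1 by lra.
(* [d] solves (M + 1) * d ^ a = eps; M itself may be 0. *)
pose d := (eps / (M + 1)) `^ a^-1.
have d0 : 0 < d by rewrite powR_gt0// divr_gt0.
have n0 : 0 < (n%:R + 1 : R) by rewrite ltr_wpDl.
apply/nbhs_ballP; exists (d / (n%:R + 1)) => /=; first by rewrite divr_gt0.
move=> z; rewrite -ball_normE/= => xz; apply: (le_trans (hv _ _)).
have xzd : enorm (x - z) <= d.
  apply: le_trans (enorm_le_norm _) _.
  apply: (@le_trans _ _ ((n%:R + 1) * (d / (n%:R + 1)))).
    by apply: ler_pM => //; [lra|exact: ltW].
  by rewrite mulrCA divff ?mulr1// gt_eqF.
have dE : d `^ a = eps / (M + 1).
  by rewrite /d -powRrM mulVf ?gt_eqF// powRr1// ltW// divr_gt0.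
apply: (@le_trans _ _ ((M + 1) * d `^ a)).
  apply: ler_pM; rewrite ?powR_ge0//; first by lra.
  by apply: (ge0_ler_powR (ltW a0)); rewrite ?nnegrE ?enorm_ge0// ltW.
by rewrite dE mulrCA divff ?mulr1// gt_eqF.
Qed.

(** Mean value theorem along the coordinate path from x to x + y. Only partial
    derivatives are used, not differentiability. *)
Lemma coordinate_path v x y : (forall i z, derivable v z (e_ i)) ->
  exists2 xi : 'I_n -> 'rV[R]_n, forall i, enorm (xi i - x) <= enorm y &
    v (x + y) - v x = \sum_i y 0 i * 'D_(e_ i) v (xi i).
Proof.
move=> dv.
(* [p k] agrees with y in the first k coordinates and is 0 in the others. *)
pose p k : 'rV[R]_n := \row_j (if (j < k)%N then y 0 j else 0).
have pS (i : 'I_n) : p i.+1 = p i + y 0 i *: e_ i.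
  apply/rowP => j; rewrite !mxE ltnS leq_eqVlt.
  have [->|ij] := eqVneq j i; first by rewrite eqxx/= ltnn add0r mulr1.
  by rewrite andbF mulr0 addr0 (negbTE (ij : (j != i :> nat))).
have /choice[c hc] (i : 'I_n) : exists c : R, `|c| <= `|y 0 i| /\
    v (x + p i.+1) - v (x + p i) = y 0 i * 'D_(e_ i) v (x + p i + c *: e_ i).
  by have [c ch E] := MVT_line (x + p i) (y 0 i) (dv i); exists c; rewrite pS addrA.
exists (fun i : 'I_n => x + p i + c i *: e_ i) => [i|].
  rewrite (_ : _ - x = p i + c i *: e_ i); last by rewrite -(addrA x) addrAC subrr add0r.
  apply: le_enorm => j; rewrite !mxE.
  have [->|ij] := eqVneq j i.
    by rewrite ltnn add0r mulr1; have [] := hc i.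
  by rewrite mulr0 addr0; case: ifP => // _; rewrite normr0.
under eq_bigr do rewrite -(proj2 (hc _)).
rewrite -(big_mkord xpredT (fun i => v (x + p i.+1) - v (x + p i))) telescope_sumr//.
congr (v _ - v _).
  by congr (x + _); apply/rowP => j; rewrite mxE ltn_ord.
by rewrite -[LHS]addr0; congr (x + _); apply/rowP => j; rewrite !mxE.
Qed.

Lemma partials_lipschitz v (B : R) x y : 0 <= B -> (forall i z, derivable v z (e_ i)) ->
  (forall i z, `|'D_(e_ i) v z| <= B) ->
  `|v (x + y) - v x| <= n%:R * B * enorm y.
Proof.
move=> B0 dv vB; have [xi _ ->] := coordinate_path x y dv.
apply: le_trans (ler_norm_sum _ _ _) _.
apply: (@le_trans _ _ (\sum_(i < n) enorm y * B)).
  by apply: ler_sum => i _; rewrite normrM ler_pM// coord_le_enorm.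
by rewrite sumr_const card_ord -[leLHS]mulr_natl [enorm y * B]mulrC mulrA.
Qed.

(** Bounded functions with bounded partial derivatives are Hoelder continuous of
    any exponent at most 1. *)
Lemma partials_holder v (a B : R) : 0 < a <= 1 ->
  (forall z, `|v z| <= B) -> (forall i z, derivable v z (e_ i)) ->
  (forall i z, `|'D_(e_ i) v z| <= B) ->
  holder_bound a ((n%:R + 2) * B) v.
Proof.
move=> /andP[a0 a1] vB dv dB x z; set y := x - z.
have B0 : 0 <= B by apply: le_trans (vB 0); exact: normr_ge0.
have nB0 : 0 <= n%:R * B by rewrite mulr_ge0.
(* |y| <= |y| ^ a when |y| <= 1, and 1 <= |y| ^ a otherwise. *)
have [y1|y1] := leP (enorm y) 1.
  have h : enorm y <= enorm y `^ a.
    have [y0|y0] := eqVneq (enorm y) 0; first by rewrite [leLHS]y0 powR_ge0.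
    by rewrite ger1_powR// y1 andbT lt_neqAle eq_sym y0 enorm_ge0.
  have := partials_lipschitz z y B0 dv dB; rewrite /y subrKC => H.
  apply: le_trans H _; apply: ler_pM => //; first exact: enorm_ge0.
  by rewrite mulrDl lerDl mulr_ge0.
have h : 1 <= enorm y `^ a.
  by rewrite -[leLHS](powRr0 (enorm y)); apply: ler_powR; exact: ltW.
apply: le_trans (ler_normB _ _) _.
have := vB x; have := vB z => ? ?.
apply: (@le_trans _ _ ((n%:R + 2) * B)); first by lra.
by rewrite ler_peMr// mulr_ge0//; have : 0 <= (n%:R : R) by []; lra.
Qed.

Lemma second_diff_holder (a M : R) v : 0 <= M -> holder_bound a M v ->
  second_diff_bound a (2 * M) v.
Proof.
move=> M0 hv x y.
have h1 : `|v x - v (x + y)| <= M * enorm y `^ a.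
  by have := hv x (x + y); rewrite opprD addrA subrr sub0r enormN.
have h2 : `|v x - v (x - y)| <= M * enorm y `^ a.
  by have := hv x (x - y); rewrite opprB subrKC.
have -> : second_diff v x y = (v x - v (x + y)) + (v x - v (x - y)).
  by rewrite /second_diff; ring.
apply: le_trans (ler_normD _ _) _.
by rewrite -mulrA mulrDl mul1r; apply: lerD; [exact: h1|exact: h2].
Qed.

Lemma second_diff_diff_holder (a M : R) v x h y : 0 <= M -> holder_bound a M v ->
  `|second_diff v (x + h) y - second_diff v x y| <= 4 * M * enorm h `^ a.
Proof.
move=> M0 hv.
have H z : `|v (z + h) - v z| <= M * enorm h `^ a.
  by have := hv (z + h) z; rewrite addrAC subrr add0r.
have := H x; have := H (x + y); have := H (x - y).
rewrite /second_diff ![x + _ + h]addrAC !ler_norml.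
by move=> /andP[? ?] /andP[? ?] /andP[? ?]; apply/andP; split; lra.
Qed.

(** Hoelder continuous partial derivatives gain one order in the second
    difference. *)
Lemma second_diff_partials_holder (a M : R) v : 0 < a -> 0 <= M ->
  (forall i z, derivable v z (e_ i)) ->
  (forall i, holder_bound a M ('D_(e_ i) v)) ->
  second_diff_bound (1 + a) (2 * n%:R * M) v.
Proof.
move=> a0 M0 dv hv x y.
have [xi hxi E1] := coordinate_path x y dv.
have [xj hxj E2] := coordinate_path x (- y) dv.
have Di z (i : 'I_n) : enorm (z - x) <= enorm y ->
    `|'D_(e_ i) v z - 'D_(e_ i) v x| <= M * enorm y `^ a.
  move=> zx; apply: le_trans (hv i z x) _; rewrite ler_wpM2l//.
  by apply: (ge0_ler_powR (ltW a0)); rewrite ?nnegrE ?enorm_ge0.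
have -> : second_diff v x y = \sum_i y 0 i *
    (('D_(e_ i) v (xj i) - 'D_(e_ i) v x) - ('D_(e_ i) v (xi i) - 'D_(e_ i) v x)).
  have -> : second_diff v x y = - (v (x + y) - v x) - (v (x + - y) - v x).
    by rewrite /second_diff; ring.
  rewrite E1 E2 -!sumrN -big_split/=; apply: eq_bigr => i _.
  by rewrite mxE; ring.
apply: le_trans (ler_norm_sum _ _ _) _.
apply: (@le_trans _ _ (\sum_(i < n) enorm y * (2 * (M * enorm y `^ a)))).
  apply: ler_sum => i _; rewrite normrM ler_pM ?coord_le_enorm//.
  rewrite (le_trans (ler_normB _ _))// mulrDl mul1r lerD//; apply: Di => //.
  by have := hxj i; rewrite enormN.
rewrite sumr_const card_ord -[leLHS]mulr_natl powRD; last first.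
  by rewrite (_ : 1 + a == 0 = false)//; apply/eqP; lra.
rewrite powRr1 ?enorm_ge0// le_eqVlt; apply/orP; left; apply/eqP; ring.
Qed.

Lemma second_diff_diff_partials_holder (a M : R) v x h y : 0 <= M ->
  (forall i z, derivable v z (e_ i)) ->
  (forall i, holder_bound a M ('D_(e_ i) v)) ->
  `|second_diff v (x + h) y - second_diff v x y| <=
    2 * n%:R * M * enorm h * enorm y `^ a.
Proof.
move=> M0 dv hv.
have H z : `|(v (x + h) - v (x + h + z)) - (v x - v (x + z))| <=
    n%:R * (M * enorm z `^ a) * enorm h.
  pose f t := v t - v (t + z).
  have df i t : is_derive t (e_ i) f ('D_(e_ i) v t - 'D_(e_ i) v (t + z)).
    have H1 := is_derive_translate (dv i (t + z)).
    have H2 : is_derive t (e_ i) v ('D_(e_ i) v t) by apply: DeriveDef.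
    exact: (is_deriveB H2 H1).
  apply: (@partials_lipschitz f).
  - by rewrite mulr_ge0 ?powR_ge0.
  - by move=> i t; exact: (@ex_derive _ _ _ _ _ _ _ (df i t)).
  - move=> i t; rewrite (@derive_val _ _ _ _ _ _ _ (df i t)).
    apply: le_trans (hv i _ _) _.
    by rewrite opprD addrA subrr sub0r enormN.
have := H y; have := H (- y); rewrite enormN /second_diff !ler_norml.
by move=> /andP[? ?] /andP[? ?]; apply/andP; split; lra.
Qed.

End gradient_estimates.

(** * Iterated derivatives and norms *)

Section words.
Variables (R : realType) (n k : nat) (a : R) (u : 'rV[R]_n -> R).
Hypothesis hu : holder_space k a u.
Local Notation e_ := (basis_vec R).

Lemma partials_swap (i j : 'I_n) (w : seq 'I_n) : ((size w).+2 <= k)%N ->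
  partials (i :: j :: w) u = partials (j :: i :: w) u.
Proof.
move=> wk; have [hd hc _] := hu.
have w1 : (size w < k)%N by apply: leq_trans wk.
apply: (@derive_comm _ _ (partials w u) (e_ j) (e_ i)).
- by move=> z; exact: hd.
- by move=> z; exact: hd.
- by move=> z; apply: (hd (j :: w)).
- by move=> z; apply: (hd (i :: w)).
- by have [] := hc (i :: j :: w) wk.
- by have [] := hc (j :: i :: w) wk.
Qed.

(** A direction of differentiation may be moved to the front. *)
Lemma partials_front l i r : (size (l ++ i :: r) <= k)%N ->
  partials (l ++ i :: r) u = partials (i :: l ++ r) u.
Proof.
elim: l => [//|j l IHl] /= lk.
have IH := IHl (ltnW lk); rewrite [X in (fun x => 'D_ _ X x)]IH.
apply: (@partials_swap j i (l ++ r)); apply: leq_trans lk.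
by rewrite !size_cat/= addnS.
Qed.

(** Iterated derivatives depend only on the multiset of directions. *)
Lemma partials_perm w w' : (size w <= k)%N -> perm_eq w w' ->
  partials w u = partials w' u.
Proof.
elim: w w' => [|i w IHw] w' wk; first by rewrite perm_sym => /perm_nilP ->.
move=> ww'.
have iw' : i \in w' by rewrite -(perm_mem ww') mem_head.
move: ww' => /[dup] /perm_size sw'; case/splitPr: iw' sw' => l r sw' ww'.
rewrite partials_front -?sw'// /=.
rewrite [X in (fun x => 'D_ _ X x)](IHw (l ++ r))//; first exact: ltnW.
rewrite -(perm_cons i); apply: perm_trans ww' _.
by rewrite -[i :: r]cat1s perm_catCA.
Qed.

(** The nondecreasing word of directions that a multi-index stands for. *)
Definition multi_word m (g : {ffun 'I_n -> 'I_m.+1}) : seq 'I_n :=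
  flatten [seq nseq (g i) i | i <- enum 'I_n].

Lemma size_multi_word m (g : {ffun 'I_n -> 'I_m.+1}) :
  size (multi_word g) = multi_order g.
Proof.
rewrite /multi_word size_flatten /shape -map_comp sumnE big_map big_enum/=.
by apply: eq_bigr => i _; rewrite size_nseq.
Qed.

Lemma word_multi_index w : (size w <= k)%N ->
  exists2 g : {ffun 'I_n -> 'I_k.+1}, multi_order g = size w &
    multi_partial g u = partials w u.
Proof.
move=> wk; pose g : {ffun 'I_n -> 'I_k.+1} := [ffun i => inord (count_mem i w)].
have gE i : g i = count_mem i w :> nat.
  by rewrite ffunE inordK// ltnS (leq_trans _ wk)// count_size.
have pg : perm_eq w (multi_word g).
  apply/allP => x _; apply/eqP; rewrite /multi_word count_flatten -map_comp.
  rewrite sumnE big_map big_enum/= (bigD1 x)//= big1 => [|i ix].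
    by rewrite count_nseq/= eqxx mul1n addn0 gE.
  by rewrite count_nseq/= (negbTE ix).
exists g; first by rewrite -size_multi_word (perm_size pg).
by rewrite /multi_partial -/(multi_word g) (partials_perm wk pg).
Qed.

End words.

Section norms.
Variables (R : realType) (n : nat).
Hypothesis hn : (1 <= n)%N.
Implicit Types (f u : 'rV[R]_n -> R).

Lemma sup_norm_ge0 f : (0 <= sup_norm f)%E.
Proof.
apply: (@le_trans _ _ (`|f 0|)%:E); first by rewrite lee_fin.
by apply: ereal_sup_ubound; exists 0.
Qed.

Lemma sup_norm_leP f (B : R) : (sup_norm f <= B%:E)%E <-> forall x, `|f x| <= B.
Proof.
split=> [h x|h].
  by rewrite -lee_fin; apply: le_trans h; apply: ereal_sup_ubound; exists x.
by apply: ge_ereal_sup => _ [x _ <-]; rewrite lee_fin.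
Qed.

Lemma holder_seminorm_ge0 b f : (0 <= holder_seminorm b f)%E.
Proof.
pose i : 'I_n := Ordinal hn.
apply: (@le_trans _ _ (`|f (basis_vec R i) - f 0| / enorm (basis_vec R i - 0) `^ b)%:E).
  by rewrite lee_fin divr_ge0// powR_ge0.
apply: ereal_sup_ubound; exists (basis_vec R i, 0) => //=.
by move=> /rowP /(_ i); rewrite !mxE !eqxx/=; apply/eqP; rewrite oner_neq0.
Qed.

Lemma holder_seminorm_leP b f (M : R) : 0 <= M ->
  (holder_seminorm b f <= M%:E)%E <-> holder_bound b M f.
Proof.
move=> M0; split=> [h x z|h].
  have [->|/eqP xz] := eqVneq x z.
    by rewrite subrr normr0 mulr_ge0// powR_ge0.
  have xz0 : 0 < enorm (x - z) `^ b.
    by rewrite powR_gt0// enorm_gt0 subr_eq0; apply/eqP.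
  rewrite -ler_pdivrMr// -lee_fin; apply: le_trans h.
  by apply: ereal_sup_ubound; exists (x, z).
apply: ge_ereal_sup => _ [[x z] /= xz <-]; rewrite lee_fin.
have xz0 : 0 < enorm (x - z) `^ b.
  by rewrite powR_gt0// enorm_gt0 subr_eq0; apply/eqP.
by rewrite ler_pdivrMr//; exact: h.
Qed.

(** The norm of the space controls all iterated derivatives, whatever the order
    of the differentiations. *)
Lemma holder_normE k (a : R) u : holder_space k a u ->
  exists2 N : R, 0 <= N & [/\ holder_norm k a u = N%:E,
    forall w x, (size w <= k)%N -> `|partials w u x| <= N &
    forall w, size w = k -> holder_bound a N (partials w u)].
Proof.
move=> hu; have [_ hc hh] := hu.
pose S1 := (\sum_(g : {ffun 'I_n -> 'I_k.+1} | (multi_order g <= k)%N)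
      sup_norm (multi_partial g u))%E.
pose S2 := (\sum_(g : {ffun 'I_n -> 'I_k.+1} | multi_order g == k)
      holder_seminorm a (multi_partial g u))%E.
have S10 : (0 <= S1)%E by apply: sume_ge0 => g _; exact: sup_norm_ge0.
have S20 : (0 <= S2)%E by apply: sume_ge0 => g _; exact: holder_seminorm_ge0.
have S1oo : (S1 < +oo)%E.
  apply: lte_sum_pinfty => g gk.
  by have [] := hc (multi_word g); rewrite ?size_multi_word.
have S2oo : (S2 < +oo)%E.
  apply: lte_sum_pinfty => g /eqP gk.
  by apply: (hh (multi_word g)); rewrite size_multi_word.
have NE : holder_norm k a u = (S1 + S2)%E by [].
have Nfin : (S1 + S2)%E \is a fin_num.
  by rewrite ge0_fin_numE ?adde_ge0// lte_add_pinfty.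
exists (fine (S1 + S2)%E); first by rewrite fine_ge0// adde_ge0.
split; first by rewrite fineK.
- move=> w x wk; have [g gw <-] := word_multi_index hu wk.
  apply/sup_norm_leP: x; rewrite fineK//.
  apply: (@le_trans _ _ S1); last by rewrite leeDl.
  rewrite /S1 (bigD1 g)/=; last by rewrite gw.
  by rewrite leeDl// sume_ge0// => g' _; exact: sup_norm_ge0.
- move=> w wk; have [g gw <-] := word_multi_index hu (eq_leq wk).
  apply/holder_seminorm_leP; first by rewrite fine_ge0// adde_ge0.
  rewrite fineK//; apply: (@le_trans _ _ S2); last by rewrite leeDr.
  rewrite /S2 (bigD1 g)/=; last by rewrite gw wk.
  by rewrite leeDl// sume_ge0// => g' _; exact: holder_seminorm_ge0.
Qed.

(** Uniform bounds on all iterated derivatives give membership and a bound of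
    the norm, up to the number of multi-indices. *)
Lemma holder_space_intro k (b : R) f (S : R) : 0 < b -> 0 <= S ->
  (forall w i x, (size w < k)%N -> derivable (partials w f) x (basis_vec R i)) ->
  (forall w x, (size w <= k)%N -> `|partials w f x| <= S) ->
  (forall w, (size w <= k)%N -> holder_bound b S (partials w f)) ->
  holder_space k b f /\
  (holder_norm k b f <= (2 * #|{ffun 'I_n -> 'I_k.+1}|%:R * S)%:E)%E.
Proof.
move=> b0 S0 fd fb fh; split.
  split=> // w wk; first split.
  - exact: holder_continuous b0 S0 (fh w wk).
  - apply: (@le_lt_trans _ _ S%:E); last exact: ltry.
    by apply/sup_norm_leP => x; exact: fb.
  - apply: (@le_lt_trans _ _ S%:E); last exact: ltry.
    by apply/(holder_seminorm_leP _ _ S0); apply: fh; rewrite wk.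
have sumS (P : pred {ffun 'I_n -> 'I_k.+1}) (F : {ffun 'I_n -> 'I_k.+1} -> \bar R) :
    (forall g, P g -> (F g <= S%:E)%E) ->
    (\sum_(g | P g) F g <= (#|{ffun 'I_n -> 'I_k.+1}|%:R * S)%:E)%E.
  move=> FS; apply: (@le_trans _ _ (\sum_(g | P g) S%:E)%E); first exact: lee_sum.
  rewrite sumEFin lee_fin sumr_const -[leLHS]mulr_natl ler_wpM2r// ler_nat.
  exact: max_card.
rewrite -mulrA mulrDl mul1r EFinD; apply: leeD; apply: sumS => g gk.
  by apply/sup_norm_leP => x; apply: fb; rewrite size_multi_word.
apply/(holder_seminorm_leP _ _ S0); apply: fh.
by rewrite size_multi_word (eqP gk).
Qed.

End norms.

(** * Schauder estimates *)

Section schauder.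
Variables (R : realType) (n k : nat) (s a : R).
Hypotheses (hn : (1 <= n)%N) (s0 : 0 < s) (s1 : s < 1) (ha : 0 < a <= 1).
Implicit Types (u v : 'rV[R]_n -> R) (w : seq 'I_n).

(** The three pointwise properties of an iterated derivative that enter the
    estimates: Hoelder continuity, a bound on its second differences, and a
    bound on the increments of its second differences. *)
Definition regular (g b M : R) v : Prop :=
  [/\ holder_bound a M v, second_diff_bound g M v &
      forall x h y, `|second_diff v (x + h) y - second_diff v x y|
        <= M * enorm h `^ (g - b) * enorm y `^ b].

Lemma holder_bound_le (M M' : R) v : M <= M' -> holder_bound a M v -> holder_bound a M' v.
Proof.
by move=> MM' hv x z; rewrite (le_trans (hv x z))// ler_wpM2r ?powR_ge0.
Qed.

Lemma second_diff_bound_le (g M M' : R) v :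
  M <= M' -> second_diff_bound g M v -> second_diff_bound g M' v.
Proof.
by move=> MM' hv x y; rewrite (le_trans (hv x y))// ler_wpM2r ?powR_ge0.
Qed.

(** The operator commutes with iterated derivatives. *)
Lemma partials_frac_laplacian (K : nat) (g b M : R) u : 2 * s < g -> 0 <= M ->
  (forall w i x, (size w < K)%N -> derivable (partials w u) x (basis_vec R i)) ->
  (forall w, (size w <= K)%N -> admissible s (partials w u)) ->
  (forall w, (size w <= K)%N -> regular g b M (partials w u)) ->
  forall w, (size w <= K)%N ->
    partials w (frac_laplacian s u) = frac_laplacian s (partials w u) /\
    ((size w < K)%N -> forall i x, is_derive x (basis_vec R i)
      (frac_laplacian s (partials w u)) (frac_laplacian s (partials (i :: w) u) x)).
Proof.
move=> sg M0 du au ru.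
have D w i x : (size w < K)%N -> is_derive x (basis_vec R i)
      (frac_laplacian s (partials w u)) (frac_laplacian s (partials (i :: w) u) x).
  move=> wK; have [hM dM _] := ru (i :: w) wK.
  have a0 : 0 < a by case/andP: ha.
  apply: (@frac_laplacian_derive _ _ _ s0 _ sg _ _ M M a) => //.
  - exact: au (ltnW wK).
  - by move=> z; exact: du.
  - exact: (au (i :: w) wK).
move=> w wK; split; last by move=> wK' i x; exact: D.
elim: w wK => [//|i w IHw] /= wK.
apply/funext => x; rewrite [X in derive X](IHw (ltnW wK)).
exact: (@derive_val _ _ _ _ _ _ _ (D w i x wK)).
Qed.

(** The conclusion of the theorem, with exponent g - 2s, for any class whose
    derivatives of order at most K are regular. *)
Lemma schauder_of_regular (K : nat) (g b C1 : R) : (K <= k)%N ->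
  b < 2 * s < g -> 0 <= C1 ->
  (forall u (N : R), 0 <= N -> holder_space k a u ->
     (forall w x, (size w <= k)%N -> `|partials w u x| <= N) ->
     (forall w, size w = k -> holder_bound a N (partials w u)) ->
     forall w, (size w <= K)%N -> regular g b (C1 * N) (partials w u)) ->
  exists2 C : R, 0 < C & forall u, holder_space k a u ->
    [/\ has_frac_laplacian s u,
        holder_space K (g - 2 * s) (frac_laplacian s u) &
        (holder_norm K (g - 2 * s) (frac_laplacian s u)
          <= C%:E * holder_norm k a u)%E].
Proof.
move=> Kk /andP[bs sg] C10 H.
have [C2 C20 H2] := @frac_laplacian_sup R n s s0 g sg.
have [C3 C30 H3] := @frac_laplacian_holder R n s s0 g sg b bs.
pose C4 := C2 * (C1 + 1) + C3 * (C1 + C1).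
have C40 : 0 <= C4 by rewrite addr_ge0// mulr_ge0// addr_ge0.
pose m : R := #|{ffun 'I_n -> 'I_K.+1}|%:R.
have m0 : 0 <= m by exact: ler0n.
exists (2 * m * C4 + 1); first by rewrite ltr_wpDl// !mulr_ge0.
move=> u hu; have [hd hc _] := hu.
have [N N0 [NE Nb Nh]] := holder_normE hn hu.
have CN0 : 0 <= C1 * N by rewrite mulr_ge0.
have reg w : (size w <= K)%N -> regular g b (C1 * N) (partials w u).
  by move=> wK; exact: H Nb Nh w wK.
have adm w : (size w <= K)%N -> admissible s (partials w u) /\
    forall x, `|frac_laplacian s (partials w u) x| <= C2 * (C1 * N + N).
  move=> wK; have wk := leq_trans wK Kk; have [_ sd _] := reg w wK.
  by apply: H2 => //; [have [] := hc w wk|move=> z; exact: Nb].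
have hol w : (size w <= K)%N ->
    holder_bound (g - 2 * s) (C3 * (C1 * N + C1 * N)) (frac_laplacian s (partials w u)).
  move=> wK; have [_ sd sdd] := reg w wK; have [aw _] := adm w wK.
  by move=> x z; exact: (H3 _ _ _ aw CN0 CN0 sd sdd x z).
have du w i x : (size w < K)%N -> derivable (partials w u) x (basis_vec R i).
  by move=> wK; apply: hd; exact: leq_trans Kk.
have pE := @partials_frac_laplacian K g b (C1 * N) u sg CN0 du
  (fun w wK => proj1 (adm w wK)) reg.
have t1 : 0 <= C2 * (C1 * N + N) by rewrite mulr_ge0// addr_ge0.
have t2 : 0 <= C3 * (C1 * N + C1 * N) by rewrite mulr_ge0// addr_ge0.
have SE : C4 * N = C2 * (C1 * N + N) + C3 * (C1 * N + C1 * N).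
  by rewrite /C4; ring.
have [|||||hs hN] := @holder_space_intro R n K (g - 2 * s) (frac_laplacian s u) (C4 * N).
- by rewrite subr_gt0.
- exact: mulr_ge0.
- move=> w i x wK; have [-> D] := pE w (ltnW wK).
  exact: (@ex_derive _ _ _ _ _ _ _ (D wK i x)).
- move=> w x wK; have [-> _] := pE w wK; have [_ h] := adm w wK.
  by apply: le_trans (h x) _; rewrite SE lerDl.
- move=> w wK; have [-> _] := pE w wK.
  move=> x z; apply: le_trans (hol w wK x z) _.
  by rewrite ler_wpM2r ?powR_ge0// SE lerDr.
split=> //.
  by apply: admissible_has_frac_laplacian => //; exact: (proj1 (adm [::] _)).
apply: le_trans hN _; rewrite NE -EFinM lee_fin -/m.
rewrite (_ : (2 * m * C4 + 1) * N = 2 * m * (C4 * N) + N); last by ring.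
by rewrite lerDl.
Qed.

(** Derivatives of order less than [k] are also Hoelder continuous, because they
    are bounded with bounded gradient. *)
Lemma partials_holder_bound u (N : R) w : 0 <= N -> holder_space k a u ->
  (forall w x, (size w <= k)%N -> `|partials w u x| <= N) ->
  (forall w, size w = k -> holder_bound a N (partials w u)) ->
  (size w <= k)%N -> holder_bound a ((n%:R + 2) * N) (partials w u).
Proof.
move=> N0 [hd _ _] Nb Nh; rewrite leq_eqVlt => /orP[/eqP wk|wk].
  apply: holder_bound_le (Nh w wk).
  by rewrite ler_peMl//; have : 0 <= (n%:R : R) by []; lra.
apply: partials_holder => //.
- by move=> z; apply: Nb; exact: ltnW.
- by move=> i z; exact: hd.
- by move=> i z; exact: (Nb (i :: w)).
Qed.

(** Below order one, second differences are controlled by the Hoelder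
    condition. *)
Lemma regular_holder u (N : R) w : 0 <= N -> holder_space k a u ->
  (forall w x, (size w <= k)%N -> `|partials w u x| <= N) ->
  (forall w, size w = k -> holder_bound a N (partials w u)) ->
  (size w <= k)%N -> regular a 0 (4 * (n%:R + 2) * N) (partials w u).
Proof.
move=> N0 hu Nb Nh wk.
have hv := partials_holder_bound N0 hu Nb Nh wk.
have n0 : 0 <= (n%:R : R) by [].
have M0 : 0 <= (n%:R + 2) * N by rewrite mulr_ge0// addr_ge0.
split.
- by apply: holder_bound_le hv; rewrite -mulrA; lra.
- by apply: second_diff_bound_le (second_diff_holder M0 hv); rewrite -mulrA; lra.
- move=> x h y; rewrite subr0 powRr0 mulr1 -[4 * _ * N]mulrA.
  exact: second_diff_diff_holder M0 hv.
Qed.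

(** One derivative further, they gain one order. *)
Lemma regular_partials u (N : R) w : 0 <= N -> holder_space k a u ->
  (forall w x, (size w <= k)%N -> `|partials w u x| <= N) ->
  (forall w, size w = k -> holder_bound a N (partials w u)) ->
  (size w < k)%N ->
  regular (1 + a) a ((2 * n%:R + 1) * (n%:R + 2) * N) (partials w u).
Proof.
move=> N0 hu Nb Nh wk; have [hd _ _] := hu.
have hv := partials_holder_bound N0 hu Nb Nh (ltnW wk).
have n0 : 0 <= (n%:R : R) by [].
set M := (n%:R + 2) * N.
have M0 : 0 <= M by rewrite mulr_ge0// addr_ge0.
have nM0 : 0 <= n%:R * M by rewrite mulr_ge0.
have a0 : 0 < a by case/andP: ha.
have hD (i : 'I_n) : holder_bound a M ('D_(basis_vec R i) (partials w u)).
  exact: (partials_holder_bound (w := i :: w) N0 hu Nb Nh wk).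
have dD (i : 'I_n) z : derivable (partials w u) z (basis_vec R i) by exact: hd.
rewrite -mulrA -/M; split.
- by apply: holder_bound_le hv; rewrite -/M; lra.
- apply: second_diff_bound_le (second_diff_partials_holder a0 M0 dD hD).
  by lra.
- move=> x h y; rewrite addrK powRr1 ?enorm_ge0//.
  apply: le_trans (second_diff_diff_partials_holder x h y M0 dD hD) _.
  rewrite ler_wpM2r ?powR_ge0// ler_wpM2r ?enorm_ge0//; lra.
Qed.

End schauder.

Unset Implicit Arguments.

Theorem theorem12 (R : realType) (n k : nat) (s a : R)
    (hn : (1 <= n)%N) (hs : 0 < s < 1) (ha : 0 < a <= 1) :
  (2 * s < a ->
    exists2 C : R, 0 < C &
    forall u : 'rV[R]_n -> R, holder_space k a u ->
      [/\ has_frac_laplacian s u,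
          holder_space k (a - 2 * s) (frac_laplacian s u)
        & (holder_norm k (a - 2 * s) (frac_laplacian s u)
             <= C%:E * holder_norm k a u)%E]) /\
  (a < 2 * s -> (1 <= k)%N -> 0 < a - 2 * s + 1 ->
    exists2 C : R, 0 < C &
    forall u : 'rV[R]_n -> R, holder_space k a u ->
      [/\ has_frac_laplacian s u,
          holder_space k.-1 (a - 2 * s + 1) (frac_laplacian s u)
        & (holder_norm k.-1 (a - 2 * s + 1) (frac_laplacian s u)
             <= C%:E * holder_norm k a u)%E]).
Proof.
have /andP[s0 s1] := hs.
have n0 : 0 <= (n%:R : R) by [].
split=> [sa|as2 k1 as0].
  apply: (@schauder_of_regular R n k s a hn s0 s1 ha k a 0 (4 * (n%:R + 2))) => //.
  - by apply/andP; split; lra.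
  - by move=> u N N0 hu Nb Nh w wk; exact: (regular_holder ha N0 hu Nb Nh wk).
rewrite (_ : a - 2 * s + 1 = (1 + a) - 2 * s); last by ring.
apply: (@schauder_of_regular R n k s a hn s0 s1 ha k.-1 (1 + a) a
  ((2 * n%:R + 1) * (n%:R + 2))) => //.
- exact: leq_pred.
- by apply/andP; split; lra.
- move=> u N N0 hu Nb Nh w wk; apply: (regular_partials ha N0 hu Nb Nh).
  by rewrite -(prednK k1) ltnS.
Qed.
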